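(* Assume the extremal function $F_n$ is nonconstant and let $\mathsf E_n=F_n^{-1}([-1,1])$. Then $\mathsf E\subset\mathsf E_n\subset\overline{\mathbb R}$ and for every gap $(\mathbf a_i,\mathbf b_i)$ of $\mathsf E$, the set $J_i=\mathsf E_n\cap[\mathbf a_i,\mathbf b_i]$ is of exactly one of the following forms: (1) $J_i=\{\mathbf a_i,\mathbf b_i\}$ (the gap is unchanged); (2) $J_i=[\mathbf a_i,v]\cup\{\mathbf b_i\}$ with $v\in(\mathbf a_i,\mathbf b_i)$, or $J_i=\{\mathbf a_i\}\cup[u,\mathbf b_i]$ with $u\in(\mathbf a_i,\mathbf b_i)$ (extension at one edge); (3) $J_i=\{\mathbf a_i,\mathbf b_i\}\cup[u,v]$ with $[u,v]\subset(\mathbf a_i,\mathbf b_i)$ and $u\neq v$ (an internal interval is added); (4) $J_i=[\mathbf a_i,\mathbf b_i]$ (the gap closes). Moreover: (i) if $x_*\in(\mathbf a_i,\mathbf b_i)$ then case (1) holds; (ii) if $(\mathbf a_i,\mathbf b_i)$ contains a point $\mathbf c$ with $D_n^\infty(\mathbf c)>0$ and $D_n^0(\mathbf c)=1$, then case (1) holds.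
   Context: Let $\mathsf E\subset\overline{\mathbb R}$ be compact, proper, with infinitely many points; gaps are connected components of $\overline{\mathbb R}\setminus\mathsf E$, written $(\mathbf a_i,\mathbf b_i)$ with $\mathbf a_i,\mathbf b_i\in\mathsf E$ in cyclic interval notation (for distinct $a,b\in\overline{\mathbb R}$, $(a,b)$ is the set of $c$ with $(a,c,b)$ cyclically ordered, i.e. $f(c)<f(b)$... precisely: $(t_0,t_1,t_2)$ is cyclically ordered if distinct and some $f\in\mathrm{PSL}(2,\mathbb R)$ has $f(t_0)=\infty$, $f(t_1)<f(t_2)$; $[a,b]=(a,b)\cup\{a,b\}$). Divisors are finitely supported $D:\overline{\mathbb C}\to\mathbb Z$; for rational $f$, $(f)_\infty,(f)_0$ are polar/zero divisors ($0$ for constants); $\mathcal L(D)=\{f\text{ rational}:(f)_\infty\le D\}$. For $\mathbf c\in\overline{\mathbb R}$, $r(z,\mathbf c)=1/(\mathbf c-z)$ if $\mathbf c\neq\infty$, $r(z,\infty)=z$. Fix $n\ge1$, an integral divisor $D_n^\infty$ of degree $n$ supported in $\overline{\mathbb R}\setminus\mathsf E$, $x_*\in\overline{\mathbb R}\setminus\mathsf E$, $d_n=D_n^\infty(x_* )$. $F_n$ is the unique maximizer of $\Re\lim_{x\to x_*}F(x)/r(x,x_* )^{d_n}$ over $F\in\mathcal L(D_n^\infty)$ with $\sup_{\mathsf E}|F|\le1$, and $D_n^0=(F_n)_0+D_n^\infty-(F_n)_\infty$. *)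

(* Defs.v *)
From HB Require Import structures.
From mathcomp Require Import all_boot all_order all_algebra.
From mathcomp Require Import all_classical all_reals all_analysis.
From mathcomp Require Import complex.
Set Implicit Arguments. Unset Strict Implicit. Unset Printing Implicit Defensive.
Import Order.TTheory GRing.Theory Num.Theory.
Import numFieldNormedType.Exports.
Local Open Scope classical_set_scope.
Local Open Scope ring_scope.
Local Open Scope complex_scope.

Section Defs.
Variable R : realType.

(** The extended real line  R̄ = R ∪ {∞}  is [option R] ([None] = ∞);
    the Riemann sphere  C̄ = C ∪ {∞}  is [option R[i]] ([None] = ∞). *)
Definition rlift (t : option R) : option R[i] := omap (fun x => x%:C) t.

Definition mob (a b c d : R) (t : option R) : option R :=
  match t with
  | Some x => if c * x + d != 0 then Some ((a * x + b) / (c * x + d)) else None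
  | None => if c != 0 then Some (a / c) else None
  end.

Definition cyc (t0 t1 t2 : option R) : Prop :=
  [/\ t0 <> t1, t1 <> t2, t0 <> t2 &
   exists a b c d : R, [/\ a * d - b * c = 1, mob a b c d t0 = None &
     exists y1 y2 : R, [/\ mob a b c d t1 = Some y1, mob a b c d t2 = Some y2 & y1 < y2]]].

Definition oitv (a b : option R) : set (option R) := fun c => cyc a c b.
Definition citv (a b : option R) : set (option R) :=
  fun c => oitv a b c \/ c = a \/ c = b.

(** compactness of a subset of R̄ (one-point compactification of R):
    closed in R̄, i.e. its finite part is closed in R and, if it avoids ∞,
    bounded. *)
Definition ext_compact (E : set (option R)) : Prop :=
  closed [set x : R | E (Some x)] /\
  (~ E None -> exists M : R, forall x, E (Some x) -> `|x| <= M).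

(** (a,b) is a gap of E: a connected component of R̄ \ E, i.e. a maximal open
    arc of R̄ \ E, with endpoints a, b in E. *)
Definition gap (E : set (option R)) (a b : option R) : Prop :=
  [/\ E a, E b, a <> b & forall t, oitv a b t -> ~ E t].

Record ratf := RatF {
  num : {poly R[i]};
  den : {poly R[i]};
  ratf_coprime : coprimep num den;
  ratf_monic : den \is monic }.

Definition reval (f : ratf) (z : option R[i]) : option R[i] :=
  match z with
  | Some w => if (den f).[w] != 0 then Some ((num f).[w] / (den f).[w]) else None
  | None =>
      if (size (num f) < size (den f))%N then Some 0
      else if size (num f) == size (den f)
           then Some (lead_coef (num f) / lead_coef (den f)) else None
  end.

(** polar divisor (f)_∞ and zero divisor (f)_0 (both 0 for constants) *)
Definition poldiv (f : ratf) (z : option R[i]) : nat :=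
  match z with
  | Some w => mup w (den f)
  | None => if num f != 0 then (size (num f) - size (den f))%N else 0%N
  end.
Definition zerdiv (f : ratf) (z : option R[i]) : nat :=
  if num f == 0 then 0%N else
  match z with
  | Some w => mup w (num f)
  | None => (size (den f) - size (num f))%N
  end.

Definition is_const (f : ratf) : Prop := exists c : R[i], forall z, reval f z = Some c.

(** an integral divisor D supported in R̄, viewed as a divisor on C̄ *)
Definition extD (D : option R -> nat) (z : option R[i]) : nat :=
  match z with
  | None => D None
  | Some w => if complex.Im w == 0 then D (Some (complex.Re w)) else 0%N
  end.

Definition inL (D : option R -> nat) (f : ratf) : Prop :=
  forall z, (poldiv f z <= extD D z)%N.

Definition sup_le1 (E : set (option R)) (f : ratf) : Prop :=
  forall t, E t -> exists w, reval f (rlift t) = Some w /\ `|w| <= 1.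

(** f as a function of a real variable (away from poles) *)
Definition rfun (f : ratf) (x : R) : R[i] := (num f).[x%:C] / (den f).[x%:C].

(** [objlim f xs d l] : Re lim_{x -> xs} f(x)/r(x,xs)^d = l, the limit being
    taken along real x (the limit exists for f in L(D)). *)
Definition objlim (f : ratf) (xs : option R) (d : nat) (l : R) : Prop :=
  match xs with
  | Some c => (fun x : R => complex.Re (rfun f x * (c%:C - x%:C) ^+ d)) x @[x --> c^'] --> l
  | None => (fun x : R => complex.Re (rfun f x / (x%:C) ^+ d)) x @[x --> +oo] --> l /\
            (fun x : R => complex.Re (rfun f x / (x%:C) ^+ d)) x @[x --> -oo] --> l
  end.

Definition shape1 (J : set (option R)) (a b : option R) : Prop :=
  forall x, J x <-> (x = a \/ x = b).
Definition shape2 (J : set (option R)) (a b : option R) : Prop :=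
  (exists v, oitv a b v /\ forall x, J x <-> (citv a v x \/ x = b)) \/
  (exists u, oitv a b u /\ forall x, J x <-> (x = a \/ citv u b x)).
Definition shape3 (J : set (option R)) (a b : option R) : Prop :=
  exists u v, [/\ u <> v, (forall x, citv u v x -> oitv a b x) &
                 forall x, J x <-> [\/ x = a, x = b | citv u v x]].
Definition shape4 (J : set (option R)) (a b : option R) : Prop :=
  forall x, J x <-> citv a b x.

Definition exactly_one4 (P1 P2 P3 P4 : Prop) : Prop :=
  [\/ [/\ P1, ~ P2, ~ P3 & ~ P4], [/\ ~ P1, P2, ~ P3 & ~ P4],
      [/\ ~ P1, ~ P2, P3 & ~ P4] | [/\ ~ P1, ~ P2, ~ P3 & P4]].

End Defs.

(* Main.v *)
Require Import Defs.
From HB Require Import structures.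
From mathcomp Require Import all_boot all_order all_algebra.
From mathcomp Require Import all_classical all_reals all_analysis.
From mathcomp Require Import complex.
From mathcomp Require Import ring lra zify.
Set Implicit Arguments. Unset Strict Implicit. Unset Printing Implicit Defensive.
Import Order.TTheory GRing.Theory Num.Theory.
Import numFieldNormedType.Exports.
Local Open Scope classical_set_scope.
Local Open Scope ring_scope.
Local Open Scope complex_scope.

(** Write [F = P / Q], where [Q] is the form of degree [n] with divisor [D] and
    [P] a form of degree [n]; [P] and [Q] may have common zeros. A real Moebius
    change of variable sends [xs] to infinity, so that the objective becomes the
    leading coefficient of [P]. Uniqueness of the maximizer first shows that [P]
    is real (compare with its real part). It then gives a Chebyshev alternation:
    there are [n + 1] points of [E] at which [|P| = |Q|] and [P] alternates in
    sign, since otherwise a polynomial of degree less than [n] separates the two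
    kinds of extremal points and [P] can be perturbed without changing the
    objective. For each [c] in [[-1, 1]] the level polynomial [P - c Q] then
    alternates weakly at [n + 1] points and has degree at most [n], and a nonzero
    polynomial of degree less than [n] cannot do so. Dividing out suitable factors,
    or inserting extra nodes, shows that [P - c Q] has no non-real zero, no zero
    in the arc between the last and the first node (which contains [xs]), and that
    between consecutive nodes it changes sign once, in a direction that does not
    depend on [c]. In a gap, [|F| <= 1] means that [P - Q] and [P + Q] have weakly
    opposite signs, so this holds exactly between their two sign changes; when [P]
    and [Q] have a common zero in the gap, it holds nowhere in the gap. *)

(** * Weak sign alternation of real polynomials at increasing nodes *)

Section Alternation.
Variable R : realType.
Implicit Types (p q r m : {poly R}) (s : seq R) (e : bool).

(** The inequalities are weak, so a zero of [p] fits either sign and can be added to the list as an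
    extra node. The boolean [e] is the sign at the first node, [false] standing for nonnegative. *)
Fixpoint alternates e s p : bool :=
  if s is x :: s' then (0 <= (-1) ^+ e * p.[x]) && alternates (~~ e) s' p
  else true.

Lemma alternates_cat e s1 s2 p :
  alternates e (s1 ++ s2) p =
  alternates e s1 p && alternates (e (+) odd (size s1)) s2 p.
Proof.
elim: s1 e => [|x s1 IH] e /=; first by rewrite addbF.
by rewrite IH andbA addbN addNb.
Qed.

Lemma alternates_div e s m r :
  (forall x, x \in s -> 0 < m.[x]) -> alternates e s (m * r) -> alternates e s r.
Proof.
elim: s e => [//|x s IH] e mpos /= /andP[h1 h2].
rewrite IH ?andbT //; last by move=> y ys; apply: mpos; rewrite inE ys orbT.
have mx : 0 < m.[x] by apply: mpos; rewrite inE eqxx.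
by move: h1; rewrite hornerM mulrCA pmulr_rge0.
Qed.

Lemma alternates_divN e s m r :
  (forall x, x \in s -> m.[x] < 0) -> alternates e s (m * r) ->
  alternates (~~ e) s r.
Proof.
elim: s e => [//|x s IH] e mneg /= /andP[h1 h2].
rewrite IH ?andbT //; last by move=> y ys; apply: mneg; rewrite inE ys orbT.
have mx : m.[x] < 0 by apply: mneg; rewrite inE eqxx.
by move: h1; rewrite hornerM mulrCA nmulr_rge0 // signrN mulNr oppr_ge0.
Qed.

Lemma poly_ivt_le p (a b : R) e : a <= b ->
  0 <= (-1) ^+ e * p.[a] -> 0 <= (-1) ^+ (~~ e) * p.[b] ->
  exists2 x, a <= x <= b & root p x.
Proof.
move=> ab; rewrite signrN mulNr oppr_ge0; case: e; rewrite ?expr0 ?expr1 => ha hb.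
  apply: poly_ivt => //; lra.
have [|x xab rx] := @poly_ivt _ (- p) a b ab.
  rewrite !hornerN; lra.
by exists x => //; rewrite rootN in rx.
Qed.

(* A root between the first two nodes is divided out; the quotient alternates
   once the node lying on the wrong side of that root (the first one, or the
   second one when it is the root itself) is dropped. *)
Lemma alternates_eq0 e s p :
  sorted <%R s -> (size p < size s)%N -> alternates e s p -> p = 0.
Proof.
(* The induction is on the length of the list: when the second node is dropped, the remaining list
   is not a tail of [s]. *)
have [k] := ubnP (size s); elim: k s e p => [//|k IH] [//|x [|y s]] e p.
  by move=> _ _; rewrite /= ltnS leqn0 size_poly_eq0 => /eqP.
rewrite [size _]/= ltnS => sk /= /andP[xy sy] szp /andP[px /andP[py ps]].
have ltys z : z \in s -> y < z.
  by move: sy; rewrite lt_path_sortedE => /andP[/allP h _] /h.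
have srt : sorted <%R s by apply: path_sorted sy.
have srx : path <%R x s by apply: path_le (xy) sy => a b c; apply: lt_trans.
have key z r e' t : p = ('X - z%:P) * r -> alternates e' t r ->
    sorted <%R t -> size t = (size s).+1 -> p = 0.
  move=> pE rt st szt; suff r0 : r = 0 by rewrite pE r0 mulr0.
  have [//|r0] := eqVneq r 0.
  apply: (IH t e') => //; first by rewrite szt.
  by move: szp; rewrite pE mulrC size_Mmonic ?monicXsubC // size_XsubC addn2 szt.
have [px0|px0] := eqVneq p.[x] 0.
  have /factor_theorem[r] : root p x by apply/eqP.
  rewrite mulrC => pE; apply: (key x r (~~ e) (y :: s)) => //.
  apply: (@alternates_div _ _ ('X - x%:P)); last by rewrite -pE /= py.
  move=> z; rewrite inE !hornerE subr_gt0 => /orP[/eqP->//|/ltys].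
  exact: lt_trans.
have [py0|py0] := eqVneq p.[y] 0.
  have /factor_theorem[r] : root p y by apply/eqP.
  rewrite mulrC => pE; apply: (key y r (~~ e) (x :: s)) => //=.
  apply/andP; split.
    have : alternates e [:: x] (('X - y%:P) * r) by rewrite -pE /= px.
    move/alternates_divN => /(_ _)/=; rewrite andbT; apply=> z.
    by rewrite inE => /eqP->; rewrite !hornerE subr_lt0.
  apply: (@alternates_div _ _ ('X - y%:P)); last by rewrite -pE.
  by move=> z /ltys; rewrite !hornerE subr_gt0.
have [z /andP[xz zy] rz] := poly_ivt_le (ltW xy) px py.
have zny : z < y.
  rewrite lt_neqAle zy andbT; apply: contra_neq py0 => <-; exact/eqP.
have /factor_theorem[r] := rz.
rewrite mulrC => pE; apply: (key z r (~~ e) (y :: s)) => //.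
apply: (@alternates_div _ _ ('X - z%:P)); last by rewrite -pE /= py.
move=> w; rewrite inE !hornerE subr_gt0 => /orP[/eqP->//|/ltys].
exact: lt_trans.
Qed.

Fixpoint alternately_in (A B : set R) s : Prop :=
  if s is x :: s' then A x /\ alternately_in B A s' else True.

Lemma closed_min (A : set R) : closed A -> A !=set0 -> has_lbound A ->
  exists2 m, A m & forall x, A x -> m <= x.
Proof.
move=> cA A0 lA; have iA : has_inf A by split.
exists (inf A); last by move=> x Ax; apply: ge_inf.
apply: cA => U /nbhs_ballP[e /= e0 eU].
have [x Ax xe] := inf_adherent e0 iA.
exists x; split=> //; apply: eU; rewrite /ball /=.
have := ge_inf lA Ax; rewrite ltr_norml; lra.
Qed.

Lemma closed_max (A : set R) : closed A -> A !=set0 -> has_ubound A ->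
  exists2 m, A m & forall x, A x -> x <= m.
Proof.
move=> cA A0 lA; have iA : has_sup A by split.
exists (sup A); last by move=> x Ax; apply: ub_le_sup.
apply: cA => U /nbhs_ballP[e /= e0 eU].
have [x Ax xe] := sup_adherent e0 iA.
exists x; split=> //; apply: eU; rewrite /ball /=.
have := ub_le_sup lA Ax; rewrite ltr_norml; lra.
Qed.

(* The clause on [x <= a] keeps track of the sign of the separating polynomial
   to the left of its roots, which is what the induction needs. *)
Lemma alternation_or_separation n (A B : set R) :
  closed A -> closed B -> has_lbound A -> has_lbound B ->
  (forall x, A x -> ~ B x) -> A !=set0 ->
  (forall b, B b -> exists2 a, A a & a < b) ->
  (exists s, [/\ size s = n.+1, sorted <%R s & alternately_in A B s]) \/
  (exists r, [/\ (size r <= n)%N, (forall x, A x -> 0 < r.[x]),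
     (forall x, B x -> r.[x] < 0) &
     forall a, A a -> (forall b, B b -> a < b) -> forall x, x <= a -> 0 < r.[x]]).
Proof.
elim: n A B => [|n IH] A B cA cB lA lB AB [a0 Aa0] dom.
  by left; exists [:: a0].
have [[b1 Bb1]|B0] := pselect (B !=set0); last first.
  right; exists 1; split=> [|x _|x Bx|a _ _ x _]; rewrite ?size_poly1 ?hornerE //.
  by case: B0; exists x.
have [b Bb bmin] := closed_min cB (ex_intro _ _ Bb1) lB.
(* The two sets exchange roles: the induction hypothesis is applied to [B] and to the part of [A]
   beyond the first point [b] of [B]. *)
pose A' := A `&` [set x | b <= x].
have cA' : closed A' by apply: closedI => //; apply: closed_ge.
have ltA' a : A' a -> b < a.
  move=> [Aa ba]; rewrite lt_neqAle ba andbT; apply/eqP => E.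
  by apply: (AB _ Aa); rewrite -E.
have lA' : has_lbound A' by exists b => x [].
case: (IH B A' cB cA' lB lA').
- by move=> x Bx [Ax _]; apply: (AB x).
- by exists b.
- by move=> a /ltA'; exists b.
- move=> [s [szs srt]]; case: s szs srt => [//|y s] szs srt altBA; left.
  have [By _] := altBA.
  have [a Aa ay] := dom _ By.
  exists (a :: y :: s); split; [by rewrite /= -szs|by rewrite /= ay|split=> //].
  have sub C1 C2 C2' t : (forall x, C2 x -> C2' x) ->
      (alternately_in C1 C2 t -> alternately_in C1 C2' t) /\
      (alternately_in C2 C1 t -> alternately_in C2' C1 t).
    move=> C12; elim: t => [//|z t [IH1 IH2]] /=; split=> -[h1 h2].
      by split=> //; apply: IH2.
    by split; [apply: C12|apply: IH1].
  by have [/(_ altBA)] := sub B A' A (y :: s) (fun x => @proj1 _ _).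
- move=> [r [szr rB rA' rlow]]; right.
  pose A1 := A `&` [set x | x <= b].
  have [a Aa ab] := dom _ Bb.
  have cA1 : closed A1 by apply: closedI => //; apply: closed_le.
  have [|a1 [Aa1 a1b] a1max] := closed_max cA1 (ex_intro _ a (conj Aa (ltW ab))).
    by exists b => x [].
  have {}a1b : a1 < b.
    rewrite lt_neqAle a1b andbT; apply/eqP => E.
    by apply: (AB _ Aa1); rewrite E.
  (* The new root is placed between [b] and the last point of [A] before it. The factor [t - X] is
     positive on its left, so it keeps the sign of [r] there and reverses it on the right. *)
  pose t := (a1 + b) / 2.
  have a1t : a1 < t by rewrite /t; lra.
  have tb : t < b by rewrite /t; lra.
  (* The clause on the left half-line is used here, with [b] as the first point of the exchanged
     pair. *)
  have rlow' x : x <= b -> 0 < r.[x] by apply: rlow => // a' /ltA'.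
  have ev x : (r * (t%:P - 'X)).[x] = r.[x] * (t - x) by rewrite !hornerE.
  have low x : x <= a1 -> 0 < (r * (t%:P - 'X)).[x].
    move=> xa1; rewrite ev mulr_gt0 //; last lra.
    by apply: rlow'; lra.
  exists (r * (t%:P - 'X)); split.
  + have [->|r0] := eqVneq r 0; first by rewrite mul0r size_poly0.
    by rewrite -opprB mulrN size_polyN size_Mmonic ?monicXsubC // size_XsubC addn2.
  + move=> x Ax; have [xb|bx] := leP x b; first by apply/low/a1max.
    have rx : r.[x] < 0 by apply: rA'; split=> //; apply: ltW.
    by rewrite ev nmulr_rgt0 //; lra.
  + move=> x Bx; have := rB _ Bx; have := bmin _ Bx => bx rx.
    by rewrite ev pmulr_rlt0 //; lra.
  + move=> a' Aa' a'B x xa'; apply: low; apply: le_trans xa' _; apply: a1max.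
    by split=> //=; apply/ltW/a'B.
Qed.

End Alternation.

(** * From a uniquely extremal polynomial to alternation *)

Section Extremal.
Variable R : realType.
Implicit Types (p q r m : {poly R}) (s : seq R) (e : bool).

Lemma compact_poly_bound (K : set R) p :
  compact K -> exists2 C : R, 0 < C & forall x, K x -> `|p.[x]| <= C.
Proof.
move=> cK; have [K0|nK] := pselect (K !=set0); last first.
  by exists 1 => // x Kx; case: nK; exists x.
have [c _ cmax] := @compact_EVT_max R R (horner (p * p)) K K0 cK
  (continuous_subspaceT (@continuous_horner _ _)).
exists ((p * p).[c] + 1) => [|x Kx].
  by rewrite hornerM -expr2; have := sqr_ge0 p.[c]; lra.
have /cmax : x \in K by rewrite inE.
rewrite hornerM -expr2 -real_normK ?num_real //.
have := normr_ge0 p.[x]; nra.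
Qed.

(** With [U = q^2 - p^2] and [V = p r], the slack after the perturbation is [U + 2 h V - h^2 r^2].
    Since [V > 0] wherever [U = 0], the maximum of [U] and [V] has a positive lower bound [d] on
    [K], and for small [h] the last term cannot make the slack negative. *)
Lemma separation_perturbation (K : set R) p q r : compact K ->
  (forall x, K x -> `|p.[x]| <= `|q.[x]|) ->
  (forall x, K x -> `|p.[x]| = `|q.[x]| -> 0 < p.[x] * r.[x]) ->
  exists2 h, 0 < h & forall x, K x -> `|(p - h *: r).[x]| <= `|q.[x]|.
Proof.
move=> cK pq sep; have [K0|nK] := pselect (K !=set0); last first.
  by exists 1 => // x Kx; case: nK; exists x.
pose U := q * q - p * p; pose V := p * r.
have UE x : U.[x] = q.[x] ^+ 2 - p.[x] ^+ 2 by rewrite /U !hornerE.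
have VE x : V.[x] = p.[x] * r.[x] by rewrite /V !hornerE.
have cUV : {within K, continuous (horner U \max horner V)}.
  by apply: continuous_subspaceT => x; apply: continuous_max;
    exact: continuous_horner.
have [c Kc cmin] := @compact_EVT_min R R _ K K0 cK cUV.
pose d : R := Num.max U.[c] V.[c].
have d0 : 0 < d.
  rewrite /d lt_max; have Kc' : K c by rewrite inE in Kc.
  have := pq c Kc'; rewrite le_eqVlt => /orP[/eqP/sep-/(_ Kc')|lt].
    by rewrite -VE => ->; rewrite orbT.
  by rewrite UE subr_gt0 -!(real_normK (num_real _.[c])) ltr_pXn2r ?nnegrE ?lt.
have [C C0 VC] := compact_poly_bound V cK.
have [C' C'0 rC] := compact_poly_bound (r * r) cK.
(* Here [C] bounds [|V|] and [C'] bounds [r^2]. The choice [h = d / M] gives [h (2 C + C' + d) = d],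
   which settles the case [U >= d]; it also gives [h <= 1] and [h C' <= d], which settles the case
   [V >= d]. *)
pose M := 2 * C + C' + d.
have M0 : 0 < M by rewrite /M; lra.
have h0 : 0 < d / M by apply: divr_gt0.
have hM : d / M * M = d by rewrite divfK ?gt_eqF.
exists (d / M) => // x Kx; set h := d / M in h0 hM *.
have h1 : h <= 1 by rewrite /h ler_pdivrMr // mul1r /M; lra.
rewrite -(@ler_pXn2r _ 2) ?nnegrE // !real_normK ?num_real //.
rewrite !hornerE -subr_ge0.
have -> : q.[x] ^+ 2 - (p.[x] - h * r.[x]) ^+ 2 =
   U.[x] + 2 * h * V.[x] - h ^+ 2 * (r * r).[x].
  by rewrite UE VE hornerM; ring.
have := VC _ Kx; rewrite ler_norml => /andP[V1 V2].
have := rC _ Kx; rewrite ler_norml => /andP[_ r2].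
have U0 : 0 <= U.[x].
  by rewrite UE subr_ge0 -!(real_normK (num_real _.[x])) lerXn2r ?nnegrE // pq.
have : d <= Num.max U.[x] V.[x] by apply: cmin; rewrite inE.
have r0 : h ^+ 2 * (r * r).[x] <= h ^+ 2 * C' by rewrite ler_wpM2l ?sqr_ge0.
have hh : h ^+ 2 * C' <= h * C'.
  by rewrite ler_wpM2r ?(ltW C'0) // expr2 ger_pMl.
have hd : h * (2 * C + C' + d) = d := hM.
have hd0 : 0 < h * d by apply: mulr_gt0.
rewrite le_max => /orP[dU|dV].
  have : - (h * C) <= h * V.[x] by rewrite -mulrN ler_pM2l.
  nra.
have : h * d <= h * V.[x] by rewrite ler_pM2l.
have hC : 0 < h * C by apply: mulr_gt0.
have : h * (h * C') <= h * d.
  rewrite ler_pM2l //; lra.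
rewrite mulrA -expr2; nra.
Qed.

Lemma closed_coincidence (K : set R) p q :
  closed K -> closed (K `&` [set x | p.[x] = `|q.[x]|]).
Proof.
move=> cK; apply: closedI => //.
have -> : [set x : R | p.[x] = `|q.[x]|] =
    (fun x => p.[x] - `|q.[x]|) @^-1` [set 0].
  apply/seteqP; split=> x /=; first by move=> ->; rewrite subrr.
  by move/eqP; rewrite subr_eq0 => /eqP.
apply: closed_comp; last exact: closed_eq.
move=> x _; apply: cvgB; first exact: continuous_horner.
by apply: cvg_norm; exact: continuous_horner.
Qed.

Lemma alternately_in_alternates (A B : set R) e s p :
  (forall x, A x -> 0 <= (-1) ^+ e * p.[x]) ->
  (forall x, B x -> 0 <= (-1) ^+ (~~ e) * p.[x]) ->
  alternately_in A B s -> alternates e s p.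
Proof.
elim: s A B e => [//|x s IH] A B e pA pB /= [Ax]; rewrite pA //=.
by apply: IH => // y; rewrite negbK; apply: pA.
Qed.

Lemma alternately_in_sub (A B K : set R) s :
  A `<=` K -> B `<=` K -> alternately_in A B s -> forall x, x \in s -> K x.
Proof.
elim: s A B => [//|x s IH] A B AK BK /= [/AK Kx] h y.
by rewrite inE => /orP[/eqP->//|]; apply: IH h y.
Qed.

(** The same nodes serve every level: at a node [p] equals [|q|] up to the prescribed sign, and
    subtracting [c *: q] with [|c| <= 1] cannot reverse that sign. *)
Lemma extremal_alternation (K : set R) (n : nat) p q :
  closed K -> compact K -> has_lbound K -> (0 < n)%N ->
  (forall x, K x -> q.[x] != 0) ->
  (forall x, K x -> `|p.[x]| <= `|q.[x]|) ->
  (forall r, (size r <= n)%N ->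
     (forall x, K x -> `|(p - r).[x]| <= `|q.[x]|) -> r = 0) ->
  exists e s, [/\ size s = n.+1, sorted <%R s, (forall x, x \in s -> K x) &
    forall c, -1 <= c <= 1 -> alternates e s (p - c *: q)].
Proof.
move=> clK cK lK n0 q0 pq uniq.
have pert r : (size r <= n)%N -> r != 0 ->
    (forall x, K x -> `|p.[x]| = `|q.[x]| -> 0 < p.[x] * r.[x]) -> False.
  move=> sr r0 sep; have [h h0 hP] := separation_perturbation cK pq sep.
  have : h *: r = 0.
    by apply: uniq hP; apply: leq_trans sr; apply: size_scale_leq.
  by move/eqP; rewrite scaler_eq0 (gt_eqF h0) (negbTE r0).
pose A e := K `&` [set x | ((-1) ^+ e *: p).[x] = `|q.[x]|].
have AK e : A e `<=` K by move=> x [].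
have cA e : closed (A e) by apply: closed_coincidence.
have AE (e : bool) x : A e x -> (-1) ^+ e * p.[x] = `|q.[x]|.
  by move=> [_ /=]; rewrite hornerZ.
have disj (e : bool) x : A e x -> ~ A (~~ e) x.
  move=> Ax /AE; rewrite signrN mulNr (AE e) // => qN.
  have /(q0 x) : K x by apply: AK Ax.
  by rewrite -normr_gt0; lra.
have lA e : has_lbound (A e) by have [l lP] := lK; exists l => x [/lP].
have cover x : K x -> `|p.[x]| = `|q.[x]| -> exists e : bool, A e x.
  move=> Kx pqx; exists (p.[x] < 0)%R; split=> //=.
  by rewrite hornerZ -pqx -normrEsign.
have noSep (e : bool) r : (size r <= n)%N -> r != 0 ->
    (forall x, A e x -> 0 < r.[x]) -> (forall x, A (~~ e) x -> r.[x] < 0) -> False.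
  move=> sr r0 rA rB; apply: (pert ((-1) ^+ e *: r)).
  - by apply: leq_trans sr; apply: size_scale_leq.
  - by rewrite scaler_eq0 signr_eq0.
  move=> x Kx pqx; have qx : 0 < `|q.[x]| by rewrite normr_gt0 q0.
  rewrite hornerZ mulrCA mulrA; have [e' Ax] := cover x Kx pqx.
  have [E|E] : e' = e \/ e' = ~~ e by move: (e) (e') => [] []; auto.
    by rewrite E in Ax; rewrite AE // mulr_gt0 // rA.
  rewrite E in Ax; have := AE _ _ Ax; have := rB _ Ax; rewrite signrN mulNr.
  by move=> rx pE; rewrite nmulr_rgt0 //; lra.
(* The sign [e] is that of the leftmost extremal point, so that every extremal point of the other
   sign has one of sign [e] to its left. *)
have [e [m [Am dom]]] : exists e (x0 : R), A e x0 /\ forall b, A (~~ e) b -> x0 < b.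
  have [none|] := pselect (forall e x, ~ A e x).
    (* Without any extremal point the constant 1 separates vacuously; it has degree less than [n]
       because [0 < n]. *)
    exfalso; apply: (@noSep false 1); rewrite ?size_poly1 ?oner_eq0 // => x Ax.
      by rewrite hornerC.
    by case: (none true x).
  move=> /existsNP[e0 /existsNP[x0 /contrapT Ax0]].
  have [|||m Am mmin] := @closed_min R (A true `|` A false).
  - exact: closedU.
  - by exists x0; case: (e0) Ax0; [left|right].
  - by have [l lP] := lK; exists l => x [] /AK/lP.
  have [e Aem] : exists e, A e m by case: Am; [exists true|exists false].
  exists e, m; split=> // b Ab; rewrite lt_neqAle mmin ?andbT; last first.
    by case: (e) Ab; [right|left].
  by apply/eqP => mb; apply: disj Aem _; rewrite mb.
have dom' b : A (~~ e) b -> exists2 a, A e a & a < b by move=> /dom; exists m.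
have [[s [szs srt alt]]|[r [szr rA rB _]]] :=
    alternation_or_separation n (cA e) (cA (~~ e)) (lA e) (lA _) (disj e)
      (ex_intro _ m Am) dom'.
- exists e, s; split=> //; first exact: alternately_in_sub (AK _) (AK _) alt.
  move=> c c1; have key e' x : A e' x -> 0 <= (-1) ^+ e' * (p - c *: q).[x].
    move=> Ax; rewrite !hornerE mulrBr AE // subr_ge0.
    apply: le_trans (ler_norm _) _.
    by rewrite !normrM normrX normrN1 expr1n mul1r ler_piMl // ler_norml.
  by apply: alternately_in_alternates alt => x; apply: key.
- exfalso; apply: (noSep e r) => //; apply/eqP => r0.
  by have := rA _ Am; rewrite r0 horner0 ltxx.
Qed.

End Extremal.

(** * Level polynomials on an interval free of nodes *)

Section Gaps.
Variable R : realType.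
Implicit Types (p q r h : {poly R}) (s : seq R) (e : bool) (a b c x y : R).

(** The threshold is the supremum of the points where [h] is negative. The point [a] is added to
    that set to keep it nonempty, so [t] may be an endpoint, in which case [h] has constant sign on
    the open interval. *)
Lemma poly_threshold h a b : a < b ->
  (forall x y, a < x -> x < y -> y < b -> 0 <= h.[x] -> 0 < h.[y]) ->
  exists t, forall y, a < y < b -> Num.sg h.[y] = Num.sg (y - t).
Proof.
move=> ab mono.
pose S := [set x | x = a \/ (a < x < b) && (h.[x] < 0)].
have hS : has_sup S.
  split; first by exists a; left.
  by exists b => x [->|/andP[/andP[_ /ltW//] _]]; apply: ltW.
exists (sup S) => y /andP[ay yb].
have pos z : sup S < z -> z < b -> 0 < h.[z].
  move=> Sz zb; have aS : a <= sup S by apply: ub_le_sup; [case: hS|left].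
  apply: (mono ((sup S + z) / 2)); [lra|lra|by []|].
  rewrite leNgt; apply/negP => hneg.
  suff : (sup S + z) / 2 <= sup S by lra.
  by apply: ub_le_sup; [case: hS|right; rewrite hneg andbT; apply/andP; split; lra].
have neg z : a < z -> z < sup S -> h.[z] < 0.
  move=> az zS; have zS' : 0 < sup S - z by lra.
  have [x Sx] := sup_adherent zS' hS; rewrite opprB addrC subrK => zx.
  case: Sx => [xa|/andP[/andP[ax xb] hx]]; first lra.
  rewrite ltNge; apply/negP => /(mono _ _ az zx xb); lra.
have [yS|Sy|yS] := ltgtP y (sup S).
- by rewrite !ltr0_sg ?subr_lt0 //; apply: neg.
- by rewrite !gtr0_sg ?subr_gt0 //; apply: pos.
(* At the threshold itself, a nonzero value would by the intermediate value theorem produce a root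
   on a side where the strict sign is already known. *)
rewrite -yS subrr sgr0; apply/eqP; rewrite sgr_eq0.
have [hy|hy|//] := ltgtP h.[y] 0.
- have [||z /andP[yz zb] /eqP hz] := @poly_ivt _ h y ((y + b) / 2); first lra.
    by rewrite ltW //= ltW // pos //; lra.
  have : y < z by rewrite lt_neqAle yz andbT; apply: contra_ltN hy => /eqP->; rewrite hz.
  by move=> yz'; have := pos z; rewrite hz ltxx -yS => /(_ yz'); lra.
- have [||z /andP[yz zb] /eqP hz] := @poly_ivt _ h ((a + y) / 2) y; first lra.
    by rewrite andbC ltW //= ltW // neg //; lra.
  have : z < y by rewrite lt_neqAle zb andbT; apply: contra_ltN hy => /eqP<-; rewrite hz.
  by move=> zy; have := neg z; rewrite hz ltxx -yS => /(_ _ zy); lra.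
Qed.

Lemma sorted_split s a b : a < b -> sorted <%R s ->
  (forall x, x \in s -> ~ a < x < b) ->
  exists s1 s2, [/\ s = s1 ++ s2, (forall x, x \in s1 -> x <= a) &
    forall x, x \in s2 -> b <= x].
Proof.
move=> ab; elim: s => [|x s IH] srt out; first by exists [::], [::].
have [||s1 [s2 [sE h1 h2]]] := IH; first exact: path_sorted srt.
  by move=> y ys; apply: out; rewrite inE ys orbT.
have [xa|ax] := leP x a.
  exists (x :: s1), s2; split=> //=; first by rewrite sE.
  by move=> y; rewrite inE => /orP[/eqP->|/h1].
have bx : b <= x.
  rewrite leNgt; apply/negP => xb; apply: (out x); first by rewrite inE eqxx.
  by rewrite ax.
exists [::], (x :: s); split=> // y; rewrite inE => /orP[/eqP->//|ys].
move: srt; rewrite /= lt_path_sortedE => /andP[/allP/(_ _ ys) xy _]; lra.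
Qed.

Lemma sorted_insert2 s1 s2 a b x y : a < x -> x < y -> y < b ->
  sorted <%R (s1 ++ s2) -> (forall z, z \in s1 -> z <= a) ->
  (forall z, z \in s2 -> b <= z) -> sorted <%R (s1 ++ [:: x, y & s2]).
Proof.
move=> ax xy yb srt h1 h2; move: srt.
rewrite !lt_sorted_pairwise !pairwise_cat /= => /and3P[r12 -> ->].
have -> : all (> x) s2 by apply/allP => z /h2; lra.
have -> : all (> y) s2 by apply/allP => z /h2; lra.
rewrite xy /= !andbT; apply/allrelP => u v /h1 ua.
by rewrite !inE => /or3P[/eqP->|/eqP->|/h2 bv]; lra.
Qed.

Variables (n : nat) (p q : {poly R}) (s : seq R) (e : bool).
Hypotheses (szs : size s = n.+1) (srt : sorted <%R s).
Hypotheses (szp : (size p <= n.+1)%N) (szq : (size q <= n.+1)%N).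
Hypothesis alt : forall c, -1 <= c <= 1 -> alternates e s (p - c *: q).
Hypothesis pq_neq0 : forall c, p - c *: q != 0.

Let szpq c : (size (p - c *: q)%R <= n.+1)%N.
Proof.
rewrite (leq_trans (size_polyD _ _)) // geq_max szp size_polyN.
by rewrite (leq_trans (size_scale_leq _ _)).
Qed.

(** A root beyond all the nodes could be appended as one more node, giving [n + 2] weak alternations
    for a nonzero polynomial of degree at most [n]. *)
Lemma level_outside c y : -1 <= c <= 1 ->
  (forall x, x \in s -> y < x) \/ (forall x, x \in s -> x < y) ->
  (p - c *: q).[y] != 0.
Proof.
move=> c1 ys; apply/negP => /eqP hy; move: (pq_neq0 c); rewrite (_ : _ - _ = 0) ?eqxx //.
case: ys => ys.
  apply: (@alternates_eq0 _ (~~ e) (y :: s)); rewrite /= ?szs ?ltnS //.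
    by rewrite lt_path_sortedE srt andbT; apply/allP.
  by rewrite hy mulr0 lexx negbK alt.
apply: (@alternates_eq0 _ e (s ++ [:: y])).
- rewrite lt_sorted_pairwise pairwise_cat -lt_sorted_pairwise srt /= ?andbT.
  by apply/allrelP => u v us; rewrite inE => /eqP->; apply: ys.
- by rewrite size_cat szs addn1 ltnS.
- by rewrite alternates_cat alt //= hy mulr0 lexx.
Qed.

(** This is the counterpart of [level_outside] for a root at infinity: a degree below [n] is already
    incompatible with [n + 1] nodes. *)
Lemma level_degree c : -1 <= c <= 1 -> (p - c *: q)`_n != 0.
Proof.
move=> c1; apply/negP => /eqP hn; move: (pq_neq0 c); rewrite (_ : _ - _ = 0) ?eqxx //.
apply: (@alternates_eq0 _ e s) => //; last exact: alt.
rewrite szs ltnS; apply/leq_sizeP => j; rewrite leq_eqVlt => /orP[/eqP<-//|nj].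
by apply: nth_default; apply: leq_trans nj.
Qed.

(** A factor positive at the nodes can be divided out without disturbing the alternation. It is
    applied to the square of a root lying between nodes and to a quadratic with nonreal roots. *)
Lemma level_factor c m r : -1 <= c <= 1 -> (forall x, x \in s -> 0 < m.[x]) ->
  (size r <= n)%N -> p - c *: q = m * r -> False.
Proof.
move=> c1 mpos szr E; move: (pq_neq0 c); rewrite E.
rewrite (@alternates_eq0 _ e s r) ?mulr0 ?eqxx ?szs //.
by apply: alternates_div mpos _; rewrite -E alt.
Qed.

(** [EP] stands for membership in the set where the rational function takes values in [[-1, 1]]. At
    a common zero of [p] and [q] the inequality between them carries no information; there
    [EP_common] supplies a level with a double root. *)
Variables (a b : R) (EP : R -> Prop).
Hypotheses (ab : a < b) (out : forall x, x \in s -> ~ a < x < b).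
Hypothesis EP_level : forall y, EP y ->
  exists2 c, -1 <= c <= 1 & (p - c *: q).[y] = 0.
Hypothesis EP_intro : forall y, `|p.[y]| <= `|q.[y]| ->
  ~ (p.[y] = 0 /\ q.[y] = 0) -> EP y.
Hypothesis EP_common : forall y, EP y -> p.[y] = 0 -> q.[y] = 0 ->
  exists c r, [/\ -1 <= c <= 1, (size r <= n)%N & p - c *: q = ('X - y%:P) ^+ 2 * r].

(** If the crossing failed, [x] and [y] could both be inserted as nodes, giving [n + 3] of them;
    inserting two keeps the parity of the nodes to the right. The sign [e'] depends only on the
    number of nodes to the left of the interval, hence not on the level. *)
Let level_crossing : exists e', forall c, -1 <= c <= 1 ->
  forall x y, a < x -> x < y -> y < b ->
  0 <= ((-1) ^+ e' *: (p - c *: q)).[x] -> 0 < ((-1) ^+ e' *: (p - c *: q)).[y].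
Proof.
have [s1 [s2 [sE h1 h2]]] := sorted_split ab srt out.
exists (e (+) odd (size s1)) => c c1 x y ax xy yb; rewrite !hornerZ => hx.
rewrite ltNge; apply/negP => hy; move: (pq_neq0 c).
rewrite (@alternates_eq0 _ e (s1 ++ [:: x, y & s2]) (p - c *: q)) ?eqxx //.
- by apply: sorted_insert2 ax xy yb _ h1 h2; rewrite -sE.
- have := szs; rewrite sE !size_cat /= !addnS ltnS => ->.
  by apply: leqW; apply: szpq.
- have := alt c1; rewrite sE !alternates_cat => /andP[-> a2] /=.
  by rewrite hx negbK a2 signrN mulNr oppr_ge0 hy.
Qed.

(** A common zero [x] is a root of every level. If [y] differs from [x], the level of [y] has two
    roots in the interval, against strict crossing; if [y = x], it has a double root, which can be
    divided out. *)
Lemma gap_common_zero x y : a < x < b -> p.[x] = 0 -> q.[x] = 0 ->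
  a < y < b -> ~ EP y.
Proof.
move=> /andP[ax xb] px qx /andP[ay yb] EPy.
have [E|xy] := eqVneq x y.
  move: px qx; rewrite E => py qy.
  have [c [r [c1 szr pE]]] := EP_common EPy py qy.
  apply: level_factor c1 _ szr pE => z zs; rewrite horner_exp !hornerE.
  rewrite exprn_even_gt0 //= subr_eq0; apply/eqP => zy.
  by apply: (out zs); rewrite zy ay.
have [c c1 hy] := EP_level EPy.
have hx : (p - c *: q).[x] = 0 by rewrite !hornerE px qx mulr0 subrr.
have [e' cross] := level_crossing.
move: xy; rewrite neq_lt => /orP[xy|yx].
  by have := cross c c1 x y ax xy yb; rewrite !hornerZ hx hy mulr0 ltxx => /(_ (lexx _)).
by have := cross c c1 y x ay yx xb; rewrite !hornerZ hx hy mulr0 ltxx => /(_ (lexx _)).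
Qed.

(** The inequality [|p| <= |q|] says that [(p - q) (p + q) <= 0], and both factors change sign in
    the same direction, each at its own threshold. *)
Lemma gap_band : exists u v, [/\ u <= v, u = v -> ~ a < u < b &
  forall y, a < y < b -> (EP y <-> u <= y <= v)].
Proof.
have [[x [xab [px qx]]]|nc] := pselect (exists x, a < x < b /\ p.[x] = 0 /\ q.[x] = 0).
  (* The band is empty in the gap; the pair [(b, b)] encodes this, as it meets the open interval
     nowhere. *)
  exists b, b; split=> // [_|y yab]; first by rewrite ltxx andbF.
  split; first by move/(gap_common_zero xab px qx yab).
  lra.
have [e' cross] := level_crossing.
have c1 : -1 <= (1 : R) <= 1 by lra.
have [t ht] := poly_threshold ab (cross 1 c1).
have cN1 : -1 <= (-1 : R) <= 1 by lra.
have [t' ht'] := poly_threshold ab (cross (-1) cN1).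
have tt y : a < y < b -> `|p.[y]| <= `|q.[y]| <->
    Num.min t t' <= y <= Num.max t t'.
  move=> yab; have -> : (`|p.[y]| <= `|q.[y]|) = ((y - t) * (y - t') <= 0).
    rewrite -sgr_le0 sgrM -ht // -ht' // -sgrM sgr_le0 !hornerZ.
    rewrite mulrACA -expr2 sqrr_sign mul1r !hornerE.
    rewrite -[LHS](@ler_pXn2r _ 2) ?nnegrE // !real_normK ?num_real //.
    by rewrite -subr_le0; congr (_ <= _); ring.
  by rewrite ge_min le_max; case: (leP t t') => tt'; split; nra.
exists (Num.min t t'), (Num.max t t'); split.
- by rewrite ge_min !le_max lexx.
(* Thresholds coinciding inside the gap would make [p - q] and [p + q] vanish together, hence also
   [p] and [q]. *)
- move=> E uab; have [ut ut'] : t = Num.min t t' /\ t' = Num.min t t'.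
    by move: E; case: (leP t t') => //; lra.
  apply: nc; exists (Num.min t t'); split=> //; move: uab; set u := Num.min t t'.
  move=> uab; have := ht' _ uab; have := ht _ uab.
  rewrite -/u in ut ut'; rewrite [in RHS]ut subrr [in X in _ -> X]ut' subrr.
  rewrite !sgr0 => /eqP; rewrite sgr_eq0 => /eqP h1 /eqP; rewrite sgr_eq0 => /eqP.
  move: h1; rewrite !hornerE => /eqP; rewrite mulf_eq0 signr_eq0 /= => /eqP h1.
  by move=> /eqP; rewrite mulf_eq0 signr_eq0 /= => /eqP h2; split; lra.
- move=> y yab; rewrite -tt //; split=> [EPy|pq]; last first.
    by apply: EP_intro pq _ => pq0; apply: nc; exists y.
  have [c cI] := EP_level EPy; rewrite !hornerE => /eqP; rewrite subr_eq0 => /eqP->.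
  by rewrite normrM ler_piMl // ler_norml.
Qed.

End Gaps.

(** * Real Moebius maps and the cyclic order *)

Section Moebius.
Variable R : realType.
Implicit Types (a b c d v w x y : R) (t : option R).

(** Homogeneous coordinates turn [mob] into a linear map, so that composition becomes a product of
    matrices. *)
Definition hpoint v w : option R := if w != 0 then Some (v / w) else None.

Lemma mob_hpoint a b c d v w : (v != 0) || (w != 0) ->
  mob a b c d (hpoint v w) = hpoint (a * v + b * w) (c * v + d * w).
Proof.
rewrite /hpoint; have [->|w0 _ /=] := eqVneq w 0.
  rewrite orbF /= => v0; rewrite !mulr0 !addr0 mulf_eq0 (negbTE v0) orbF.
  by case: eqVneq => //= c0; congr Some; field; rewrite v0 c0.
have -> : c * (v / w) + d = (c * v + d * w) / w by field.
have -> : ((c * v + d * w) / w == 0) = (c * v + d * w == 0).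
  by rewrite mulf_eq0 invr_eq0 (negbTE w0) orbF.
by case: eqVneq => //= cd0; congr Some; field; rewrite w0 cd0.
Qed.

Lemma mob_det_neq0 a b c d x : a * d - b * c != 0 ->
  (a * x + b != 0) || (c * x + d != 0).
Proof.
move=> det; have [/= ax|//] := eqVneq (a * x + b) 0.
apply: contra_neq det => cx.
have [-> ->] : b = - (a * x) /\ d = - (c * x) by split; lra.
by ring.
Qed.

Lemma mob_comp a b c d a' b' c' d' t : a * d - b * c != 0 ->
  mob a' b' c' d' (mob a b c d t) =
  mob (a' * a + b' * c) (a' * b + b' * d) (c' * a + d' * c) (c' * b + d' * d) t.
Proof.
move=> det; case: t => [x|].
  rewrite (mob_hpoint _ _ _ _ (mob_det_neq0 x det)) /=.
  have -> : a' * (a * x + b) + b' * (c * x + d) =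
    (a' * a + b' * c) * x + (a' * b + b' * d) by ring.
  have -> // : c' * (a * x + b) + d' * (c * x + d) =
    (c' * a + d' * c) * x + (c' * b + d' * d) by ring.
rewrite (@mob_hpoint _ _ _ _ a c) //; apply: contraR det.
by rewrite negb_or !negbK => /andP[/eqP-> /eqP->]; rewrite mul0r mulr0 subrr.
Qed.

Lemma mobK a b c d t : a * d - b * c = 1 ->
  mob d (- b) (- c) a (mob a b c d t) = t.
Proof.
move=> det; rewrite mob_comp ?det ?oner_eq0 //.
have -> : d * a + - b * c = 1 by rewrite -det; ring.
have -> : d * b + - b * d = 0 by ring.
have -> : - c * a + a * c = 0 by ring.
have -> : - c * b + a * d = 1 by rewrite -det; ring.
by case: t => [x|] /=; rewrite ?eqxx // mul0r add0r oner_eq0 divr1 mul1r addr0.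
Qed.

Lemma mob_inj a b c d : a * d - b * c = 1 -> injective (mob a b c d).
Proof. by move=> det; apply: can_inj => t; apply: mobK. Qed.

Lemma cyc_mob_sub a b c d t0 t1 t2 : a * d - b * c = 1 ->
  cyc (mob a b c d t0) (mob a b c d t1) (mob a b c d t2) -> cyc t0 t1 t2.
Proof.
move=> det [n01 n12 n02 [a' [b' [c' [d' [det' m0 [y1 [y2 [m1 m2 y12]]]]]]]]].
split; [by move=> E; apply: n01; rewrite E|by move=> E; apply: n12; rewrite E|
  by move=> E; apply: n02; rewrite E|].
have det0 : a * d - b * c != 0 by rewrite det oner_eq0.
move: m0 m1 m2; rewrite !mob_comp // => m0 m1 m2.
do 4!eexists; split; [|exact: m0|by exists y1, y2; split; [exact: m1|exact: m2|]].
have -> : (a' * a + b' * c) * (c' * b + d' * d) - (a' * b + b' * d) * (c' * a + d' * c)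
  = (a' * d' - b' * c') * (a * d - b * c) by ring.
by rewrite det det' mulr1.
Qed.

Lemma cyc_mob a b c d t0 t1 t2 : a * d - b * c = 1 ->
  cyc (mob a b c d t0) (mob a b c d t1) (mob a b c d t2) <-> cyc t0 t1 t2.
Proof.
move=> det; split; first exact: cyc_mob_sub.
rewrite -{1}(mobK t0 det) -{1}(mobK t1 det) -{1}(mobK t2 det).
by apply: cyc_mob_sub; rewrite -det; ring.
Qed.

(** A map of determinant 1 fixing infinity is affine with slope [a / d = 1 / d^2 > 0], so it
    preserves the order of the line. *)
Lemma cyc_None x y : cyc None (Some x) (Some y) <-> x < y.
Proof.
split=> [[_ _ _ [a [b [c [d [det]]]]]] /=|xy].
  case: eqP => //= c0 _ [y1 [y2 []]]; move: det; rewrite c0 !mul0r !add0r => det.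
  have d0 : d != 0.
    by apply: contra_eq_neq det => ->; rewrite mulr0 mulr0 subrr eq_sym oner_eq0.
  rewrite d0 => -[<-] [<-]; rewrite -subr_gt0 -mulrBl => h.
  have da : d * a = 1 by rewrite -det; ring.
  have E : d ^+ 2 * ((a * y + b - (a * x + b)) / d) = y - x.
    by rewrite -[RHS]mul1r -da; field.
  by rewrite -subr_gt0 -E mulr_gt0 // exprn_even_gt0.
split=> //; first by move=> [E]; rewrite E ltxx in xy.
exists 1, 0, 0, 1; split; rewrite /= ?eqxx //; first by ring.
exists x, y; rewrite !mul0r !add0r oner_eq0 !divr1 !mul1r !addr0; by split.
Qed.

(** The map [x -> -1 / (x - a)] sends [a] to infinity, and thus reduces arcs starting at [a] to
    half-lines. *)
Let mob_at a t : mob 0 (-1) 1 (- a) t =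
  if t is Some x then if x == a then None else Some (- (x - a)^-1) else Some 0.
Proof.
case: t => [x|] /=; last by rewrite oner_eq0 mul0r.
by rewrite mul1r subr_eq0; case: eqP => //= _; rewrite mul0r add0r mulN1r.
Qed.

Let cyc_at a b t : cyc (Some a) t (Some b) <->
  cyc None (mob 0 (-1) 1 (- a) t) (mob 0 (-1) 1 (- a) (Some b)).
Proof.
rewrite -(@cyc_mob 0 (-1) 1 (- a) (Some a)); last by ring.
by rewrite [X in cyc X _ _]mob_at eqxx.
Qed.

Lemma oitv_lt a b t : a < b ->
  oitv (Some a) (Some b) t <-> exists2 y, t = Some y & a < y < b.
Proof.
move=> ab; rewrite /oitv /= cyc_at !mob_at (gt_eqF ab).
have ba : 0 < (b - a)^-1 by rewrite invr_gt0; lra.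
case: t => [x|]; last by rewrite cyc_None; split=> [|[]//]; lra.
have [->|xa] := eqVneq x a.
  by split=> [[]//|[y [<-]]]; rewrite ltxx.
rewrite cyc_None ltrN2; split=> [h|[y [<-] /andP[ax xb]]].
  have : 0 < (x - a)^-1 by lra.
  rewrite invr_gt0 => xa'; exists x => //.
  by move: h; rewrite ltf_pV2 ?posrE; lra.
by rewrite ltf_pV2 ?posrE; lra.
Qed.

(** For [b < a] the arc passes through infinity, which satisfies the right-hand side vacuously. *)
Lemma oitv_gt a b t : b < a ->
  oitv (Some a) (Some b) t <-> forall y, t = Some y -> y < b \/ a < y.
Proof.
move=> ba; rewrite /oitv /= cyc_at !mob_at (lt_eqF ba).
have ab : (b - a)^-1 < 0 by rewrite invr_lt0; lra.
case: t => [x|]; last by rewrite cyc_None; split=> // _; lra.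
have [->|xa] := eqVneq x a.
  by split=> [[]//|/(_ a erefl)]; rewrite ltxx; lra.
rewrite cyc_None ltrN2; split=> [h y [<-]|/(_ x erefl)].
  have [xb|bx] := ltP x b; [by left|right].
  rewrite ltNge; apply/negP => xa'; have {}xa' : x < a by rewrite lt_neqAle xa.
  have : (x - a)^-1 <= (b - a)^-1 by rewrite lef_nV2 ?negrE; lra.
  lra.
case=> [xb|ax].
  by rewrite ltf_nV2 ?negrE; lra.
have : 0 < (x - a)^-1 by rewrite invr_gt0; lra.
lra.
Qed.

End Moebius.

(** * Binary forms of degree [n] and linear change of variables *)

Section Forms.

(* Polynomials of degree at most [n] are treated as binary forms of degree [n];
   the value of the form at infinity is the coefficient of degree [n]. *)
Definition pev (K : nzRingType) (n : nat) (P : {poly K}) (t : option K) : K :=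
  if t is Some x then P.[x] else P`_n.

Lemma coef_top (K : nzRingType) (m k : nat) (u v : {poly K}) :
  (size u <= m.+1)%N -> (size v <= k.+1)%N ->
  (u * v)`_(m + k) = u`_m * v`_k.
Proof.
move=> su sv; rewrite coefM (bigD1 (Ordinal (ltn_addr k (ltnSn m)))) //=.
rewrite addKn big1 ?addr0 // => i; rewrite -val_eqE /= neq_ltn => /orP[im|mi].
  rewrite [v`__]nth_default ?mulr0 //; apply: leq_trans sv _.
  by rewrite ltn_subRL ltn_add2r.
by rewrite nth_default ?mul0r //; apply: leq_trans su _.
Qed.

Variable R : realType.
Implicit Types (P Q u v : {poly R}) (a b c d x y : R) (t : option R) (n k : nat).

Lemma size_lin a b : (size (a *: 'X + b%:P)%R <= 2)%N.
Proof.
rewrite (leq_trans (size_polyD _ _)) // geq_max size_polyC.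
by rewrite (leq_trans (size_scale_leq _ _)) ?size_polyX //; case: (b != 0).
Qed.

Lemma size_linX a b i : (size ((a *: 'X + b%:P) ^+ i)%R <= i.+1)%N.
Proof.
apply: leq_trans (size_poly_exp_leq _ _) _.
by have := size_lin a b; case: (size _) => [|[|[|]]] //= _; rewrite ltnS ?mul0n ?mul1n.
Qed.

Lemma coef_linX a b i : ((a *: 'X + b%:P : {poly R}) ^+ i)`_i = a ^+ i.
Proof.
elim: i => [|i IH]; first by rewrite !expr0 coefC.
rewrite !exprS -add1n coef_top ?size_lin ?size_linX // IH.
by rewrite coefD coefZ coefX coefC /= mulr1 addr0.
Qed.

(** The substitution [(X, Y) -> (a X + b Y, c X + d Y)] in the form of degree [n], written with
    [Y = 1]. The degree is an argument because [P] may have a smaller one. *)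
Definition pmob a b c d n P : {poly R} :=
  \sum_(i < n.+1) P`_i *: ((a *: 'X + b%:P) ^+ i * (c *: 'X + d%:P) ^+ (n - i)).

(** The ratio between the image vector of [t] and the normalized coordinates of the image point,
    which are [(x, 1)] or [(1, 0)]. A form of degree [n] picks up its [n]-th power. *)
Definition mob_weight a b c d t : R :=
  if t is Some x then if c * x + d != 0 then c * x + d else a * x + b
  else if c != 0 then c else a.

Lemma mob_weight_neq0 a b c d t : a * d - b * c = 1 -> mob_weight a b c d t != 0.
Proof.
move=> det; have det0 : a * d - b * c != 0 by rewrite det oner_eq0.
case: t => [x|] /=.
  by have := mob_det_neq0 x det0; case: (eqVneq (c * x + d) 0) => [_|]; rewrite ?orbF.
case: (eqVneq c 0) => //= c0; apply: contra_neq det0 => ->.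
by rewrite c0 mul0r mulr0 subrr.
Qed.

Lemma size_pmob a b c d n P : (size (pmob a b c d n P) <= n.+1)%N.
Proof.
apply: leq_trans (size_sum _ _ _) _; apply/bigmax_leqP => i _.
apply: leq_trans (size_scale_leq _ _) _; apply: leq_trans (size_polyMleq _ _) _.
have := size_linX a b i; have := size_linX c d (n - i); have := ltn_ord i.
lia.
Qed.

Let homog_sum n P (v w : R) : (size P <= n.+1)%N ->
  \sum_(i < n.+1) P`_i * (v ^+ i * w ^+ (n - i)) =
  (if w != 0 then w else v) ^+ n * pev n P (hpoint v w).
Proof.
move=> sP; rewrite /hpoint; case: (eqVneq w 0) => [->|w0] /=.
  rewrite (bigD1 ord_max) //= subnn expr0 mulr1 big1 ?addr0 1?mulrC // => i.
  rewrite -val_eqE /= => ni; rewrite expr0n subn_eq0 leqNgt.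
  by rewrite ltn_neqAle ni -ltnS ltn_ord /= !mulr0.
rewrite (horner_coef_wide _ sP) mulr_sumr; apply: eq_bigr => i _.
rewrite [RHS]mulrCA; congr (_ * _); rewrite expr_div_n.
have -> : w ^+ n = w ^+ (n - i) * w ^+ i by rewrite -exprD subnK // -ltnS.
by rewrite -mulrA [w ^+ i * _]mulrCA divff ?expf_neq0 // mulr1 mulrC.
Qed.

Lemma pev_pmob a b c d n P t : (size P <= n.+1)%N ->
  pev n (pmob a b c d n P) t =
  mob_weight a b c d t ^+ n * pev n P (mob a b c d t).
Proof.
move=> sP; case: t => [x|] /=.
  rewrite -homog_sum // /pmob horner_sum; apply: eq_bigr => i _.
  by rewrite hornerZ hornerM !horner_exp !hornerE.
rewrite -homog_sum // /pmob coef_sum; apply: eq_bigr => i _.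
rewrite coefZ; congr (_ * _).
have := coef_top (size_linX a b i) (size_linX c d (n - i)).
by rewrite subnKC; [rewrite !coef_linX|rewrite -ltnS].
Qed.

Lemma pmobZ a b c d n e P : pmob a b c d n (e *: P) = e *: pmob a b c d n P.
Proof. by rewrite scaler_sumr; apply: eq_bigr => i _; rewrite coefZ scalerA. Qed.

Lemma pmobD a b c d n P Q :
  pmob a b c d n (P + Q) = pmob a b c d n P + pmob a b c d n Q.
Proof. by rewrite -big_split; apply: eq_bigr => i _; rewrite coefD scalerDl. Qed.

Lemma pmobB a b c d n P Q :
  pmob a b c d n (P - Q) = pmob a b c d n P - pmob a b c d n Q.
Proof. by rewrite pmobD -scaleN1r pmobZ scaleN1r. Qed.

Lemma pmob_sum a b c d n (I : finType) (F : I -> {poly R}) :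
  pmob a b c d n (\sum_i F i) = \sum_i pmob a b c d n (F i).
Proof.
apply: (big_morph _ (pmobD a b c d n)).
by apply: big1 => i _; rewrite coef0 scale0r.
Qed.

Lemma pmobXn a b c d n i : (i <= n)%N ->
  pmob a b c d n 'X^i = (a *: 'X + b%:P) ^+ i * (c *: 'X + d%:P) ^+ (n - i).
Proof.
move=> ni; rewrite /pmob (bigD1 (Ordinal (ni : (i < n.+1)%N))) //=.
rewrite coefXn eqxx scale1r big1 ?addr0 // => j; rewrite -val_eqE /= => ji.
by rewrite coefXn (negbTE ji) scale0r.
Qed.

Let poly_wide n P : (size P <= n)%N -> P = \sum_(i < n) P`_i *: 'X^i.
Proof. by move=> sP; rewrite -{1}(take_poly_id sP) /take_poly poly_def. Qed.

Lemma pmobM a b c d m k P Q : (size P <= m.+1)%N -> (size Q <= k.+1)%N ->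
  pmob a b c d (m + k) (P * Q) = pmob a b c d m P * pmob a b c d k Q.
Proof.
move=> sP sQ; rewrite {1}(poly_wide sP) {1}(poly_wide sQ) mulr_suml pmob_sum.
rewrite [pmob _ _ _ _ m _]/pmob mulr_suml; apply: eq_bigr => i _.
rewrite mulr_sumr pmob_sum [pmob _ _ _ _ k _]/pmob mulr_sumr.
apply: eq_bigr => j _.
rewrite -scalerAl -scalerAr -exprD !pmobZ pmobXn; last first.
  by apply: leq_add; rewrite -ltnS.
rewrite -!scalerAl -!scalerAr; congr (_ *: (_ *: _)).
have -> : (m + k - (i + j) = (m - i) + (k - j))%N.
  by have := ltn_ord i; have := ltn_ord j; lia.
by rewrite !exprD mulrACA.
Qed.

Lemma pmobX a b c d P k : (size P <= 2)%N ->
  pmob a b c d k (P ^+ k) = pmob a b c d 1 P ^+ k.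
Proof.
move=> sP; elim: k => [|k IH].
  by rewrite !expr0 /pmob big_ord1 coefC /= subnn !expr0 mulr1 scale1r.
rewrite !exprS -add1n pmobM // ?IH //.
apply: leq_trans (size_poly_exp_leq _ _) _.
by move: sP; case: (size _) => [|[|[|]]] //= _; rewrite ltnS ?mul0n ?mul1n.
Qed.

Lemma pmob_lin a b c d x y :
  pmob a b c d 1 (x *: 'X + y%:P) = x *: (a *: 'X + b%:P) + y *: (c *: 'X + d%:P).
Proof.
rewrite /pmob big_ord_recl big_ord1 /= subnn subn0 expr0 !expr1 mul1r mulr1.
by rewrite !coefD !coefZ !coefX !coefC /= mulr0 mulr1 add0r addr0 addrC.
Qed.

(** By linearity and multiplicativity it suffices that the inverse substitution returns the two
    linear forms to [X] and [Y], the latter appearing as the constant 1. *)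
Lemma pmobK a b c d n P : a * d - b * c = 1 -> (size P <= n.+1)%N ->
  pmob d (- b) (- c) a n (pmob a b c d n P) = P.
Proof.
move=> det sP; rewrite [RHS](poly_wide sP) [pmob a b c d n P]/pmob pmob_sum.
apply: eq_bigr => i _; rewrite pmobZ; congr (_ *: _).
have ni : (i <= n)%N by rewrite -ltnS.
have := pmobM d (- b) (- c) a (size_linX a b i) (size_linX c d (n - i)).
rewrite subnKC // => ->.
rewrite (pmobX _ _ _ _ i (size_lin a b)) (pmobX _ _ _ _ _ (size_lin c d)) !pmob_lin.
have -> : a *: (d *: 'X + (- b)%:P) + b *: ((- c) *: 'X + a%:P) = 'X :> {poly R}.
  rewrite !scalerDr !scalerA addrACA -scalerDl -!mul_polyC -!polyCM.
  have -> : a * d + b * - c = 1 by rewrite -det; ring.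
  have E : a * - b + b * a = 0 by ring.
  by rewrite -polyCD E addr0 mul1r.
have -> : c *: (d *: 'X + (- b)%:P) + d *: ((- c) *: 'X + a%:P) = 1 :> {poly R}.
  rewrite !scalerDr !scalerA addrACA -scalerDl -!mul_polyC -!polyCM -polyCD.
  have -> : c * - b + d * a = 1 by rewrite -det; ring.
  have -> : c * d + d * - c = 0 by ring.
  by rewrite mul0r add0r.
by rewrite expr1n mulr1.
Qed.

Lemma pmob_eq0 a b c d n P : a * d - b * c = 1 -> (size P <= n.+1)%N ->
  pmob a b c d n P = 0 -> P = 0.
Proof.
move=> det sP P0; rewrite -(pmobK det sP) P0 /pmob big1 // => i _.
by rewrite coef0 scale0r.
Qed.

End Forms.

(** * Rational functions represented by pairs of forms *)

Section RationalFunctions.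
Variable R : realType.
Local Notation C := R[i].
Local Notation num := Defs.num.
Implicit Types (f : ratf R) (P Q g : {poly C}) (w : C) (t : option C).

(** The factor [g] is the gcd, rescaled to make the reduced denominator monic. Keeping it explicit
    allows forms with common zeros. *)
Lemma ratf_of_polys P Q : Q != 0 -> exists f g, num f * g = P /\ den f * g = Q.
Proof.
move=> Q0; pose h := gcdp P Q; pose l := lead_coef (Q %/ h).
have h0 : h != 0 by rewrite gcdp_eq0 negb_and Q0 orbT.
have Qh0 : Q %/ h != 0 by rewrite divp_eq0 !negb_or Q0 h0 /= -leqNgt dvdp_leq ?dvdp_gcdr.
have l0 : l != 0 by rewrite lead_coef_eq0.
have cop : coprimep (l^-1 *: (P %/ h)) (l^-1 *: (Q %/ h)).
  by rewrite coprimepZl ?invr_eq0 // coprimepZr ?invr_eq0 // coprimep_div_gcd ?Q0 ?orbT.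
have mon : l^-1 *: (Q %/ h) \is monic by rewrite monicE lead_coefZ mulVf.
exists (RatF cop mon), (l *: h).
by rewrite /= -!scalerAl -!scalerAr !scalerA mulVf // !scale1r !divpK ?dvdp_gcdl ?dvdp_gcdr.
Qed.

Lemma den_neq0 f : den f != 0.
Proof. by rewrite monic_neq0 // ratf_monic. Qed.

Section Representation.
Variables (n : nat) (f : ratf R) (P Q g : {poly C}).
Hypotheses (fP : num f * g = P) (fQ : den f * g = Q) (g0 : g != 0).
Hypotheses (sP : (size P <= n.+1)%N) (sQ : (size Q <= n.+1)%N).

Lemma size_den_mul : size Q = (size (den f) + size g).-1.
Proof. by rewrite -fQ size_mul ?den_neq0. Qed.

Lemma size_num_mul : num f != 0 -> size P = (size (num f) + size g).-1.
Proof. by move=> n0; rewrite -fP size_mul. Qed.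

Let dpos : (0 < size (den f))%N. Proof. by rewrite size_poly_gt0 den_neq0. Qed.
Let gpos : (0 < size g)%N. Proof. by rewrite size_poly_gt0. Qed.

Lemma reval_None w : reval f None = Some w ->
  (size (num f - w *: den f)%R < size (den f))%N.
Proof.
have mon := monicP (ratf_monic f).
have small c : (size (num f) <= size (den f))%N ->
    (num f)`_(size (den f)).-1 = c -> (size (num f - c *: den f)%R < size (den f))%N.
  move=> sn nc; rewrite -(prednK dpos) ltnS; apply/leq_sizeP => j.
  rewrite leq_eqVlt coefB coefZ => /orP[/eqP<-|].
    by rewrite nc -/(lead_coef (den f)) mon mulr1 subrr.
  rewrite prednK // => dj; rewrite !nth_default ?mulr0 ?subrr //.
  by apply: leq_trans dj.
rewrite /=; case: ltnP => [lt [<-]|le].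
  by apply: small; [apply: ltnW|rewrite nth_default // -ltnS prednK].
case: eqP => // E [<-]; apply: small; first by rewrite E.
by rewrite mon divr1 /lead_coef E.
Qed.

Lemma reval_pev t w : reval f t = Some w -> pev n (P - w *: Q) t = 0.
Proof.
have PQ : P - w *: Q = (num f - w *: den f) * g by rewrite mulrBl fP -scalerAl fQ.
case: t => [z|] /=.
  case: eqP => // /eqP d0 [wE]; rewrite PQ -wE hornerM !hornerE divfK //.
  by rewrite subrr mul0r.
move=> /reval_None lt; apply: nth_default; rewrite PQ.
apply: leq_trans (size_polyMleq _ _) _.
move: sQ; rewrite size_den_mul; move: (size _) (size _) (size g) lt dpos gpos.
lia.
Qed.

(* Where both forms vanish, a value of [f] is attained to order two. *)
Lemma reval_pev_double t w : reval f t = Some w -> pev n Q t = 0 ->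
  if t is Some z then exists r : {poly C}, P - w *: Q = ('X - z%:P) ^+ 2 * r
  else (size (P - w *: Q)%R <= n.-1)%N.
Proof.
have PQ : P - w *: Q = (num f - w *: den f) * g by rewrite mulrBl fP -scalerAl fQ.
case: t => [z|] /=.
  case: eqP => // /eqP d0 [wE]; rewrite -fQ hornerM => /eqP.
  rewrite mulf_eq0 (negbTE d0) /= => /factor_theorem[g' gE].
  have /factor_theorem[h' hE] : root (num f - w *: den f) z.
    by apply/rootP; rewrite -wE !hornerE divfK // subrr.
  by exists (h' * g'); rewrite fQ PQ hE gE; ring.
move=> /reval_None lt Qn; rewrite PQ; apply: leq_trans (size_polyMleq _ _) _.
have : (size Q <= n)%N.
  rewrite leqNgt; apply/negP => nQ; have sE : size Q = n.+1 by lia.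
  have : lead_coef Q != 0 by rewrite lead_coef_eq0 -fQ mulf_neq0 ?den_neq0.
  by rewrite /lead_coef sE Qn eqxx.
rewrite size_den_mul; move: (size _) (size _) (size g) lt dpos gpos; lia.
Qed.

Lemma reval_quotient t : pev n Q t != 0 -> reval f t = Some (pev n P t / pev n Q t).
Proof.
case: t => [z|] /=; rewrite -fP -fQ.
  rewrite !hornerM mulf_eq0 negb_or => /andP[d0 gz].
  by rewrite d0; congr Some; field; rewrite gz d0.
(* At infinity, a nonzero coefficient of degree [n] forces [Q] to have degree exactly [n]; both top
   coefficients then factor through the leading coefficient of [g]. *)
rewrite fP fQ => Qn; have sE : size Q = n.+1.
  by apply/eqP; rewrite eqn_leq sQ ltnNge; apply: contra Qn => /(nth_default 0)->.
have nE : n = ((size (den f)).-1 + (size g).-1)%N.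
  by move: sE; rewrite size_den_mul; move: dpos gpos; lia.
have top (h : {poly C}) : (size h <= size (den f))%N ->
    (h * g)`_n = h`_(size (den f)).-1 * lead_coef g.
  by move=> sh; rewrite nE coef_top ?prednK.
have lg : lead_coef g != 0 by rewrite lead_coef_eq0.
have dn : (size (num f) <= size (den f))%N.
  have [->|n0] := eqVneq (num f) 0; first by rewrite size_poly0.
  have := sP; rewrite (size_num_mul n0) {1}nE.
  by move: dpos gpos; move: (size _) (size _) (size _); lia.
rewrite -fP -fQ !top // -/(lead_coef (den f)) (monicP (ratf_monic f)) mul1r divr1.
rewrite mulfK // ltn_neqAle dn andbT; case: eqP => [E|E] /=.
  by rewrite /lead_coef E.
rewrite nth_default // -ltnS prednK // ltn_neqAle dn andbT; exact/eqP.
Qed.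

End Representation.

(** Over an algebraically closed field [p] splits, and its linear factors are cancelled against [q]
    one at a time. *)
Lemma dvdp_of_mup_le (p q : {poly C}) : q != 0 -> p \is monic ->
  (forall w, (mup w p <= mup w q)%N) -> p %| q.
Proof.
move=> q0 pmon; have [s ->] := closed_field_poly_normal p.
rewrite (monicP pmon) scale1r; elim: s q q0 => [|z s IH] q q0 pq.
  by rewrite big_nil dvd1p.
have : ('X - z%:P) %| q.
  by rewrite XsubC_dvd //; apply: leq_trans (pq z); rewrite mu_prod_XsubC /= eqxx; lia.
move=> /dvdpP[q' qE]; rewrite qE big_cons mulrC dvdp_mul2r ?polyXsubC_eq0 //.
have q'0 : q' != 0 by apply: contra_neq q0; rewrite qE => ->; rewrite mul0r.
apply: IH => // w; have := pq w.
rewrite qE mupM ?polyXsubC_eq0 // -['X - z%:P]expr1 mup_XsubCX.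
by rewrite !mu_prod_XsubC /=; case: eqP => _; lia.
Qed.

(** Coprimality with a proportional numerator leaves no room for a nonconstant denominator; being
    monic, it is 1. *)
Lemma is_const_proportional f w : num f = w *: den f -> is_const f.
Proof.
move=> nE; have dE : den f = 1.
  have sd : size (den f) == 1%N.
    have := ratf_coprime f; rewrite nE; have [->|w0] := eqVneq w 0.
      by rewrite scale0r coprime0p -size_poly_eq1.
    by rewrite coprimepZl // coprimepp.
  have := monicP (ratf_monic f); rewrite lead_coefE (eqP sd) => d1.
  by rewrite (size1_polyC (eq_leq (eqP sd))) d1.
exists w => -[z|] /=.
  by rewrite nE dE !hornerE oner_eq0 /= ?mulr1 divr1.
rewrite nE dE size_poly1; have [->|w0] := eqVneq w 0.
  by rewrite scale0r size_poly0.
by rewrite size_scale // size_poly1 ltnn eqxx lead_coefZ lead_coef1 mulr1 divr1.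
Qed.

End RationalFunctions.

(** * Real forms, real parts, and limits of quotients of forms *)

Section RealForms.
Variable R : realType.
Local Notation C := R[i].
Implicit Types (P Q r : {poly R}) (x y c : R) (t : option R).

Definition cpoly P : {poly C} := map_poly (real_complex R) P.

Lemma pev_cpoly n P t : pev n (cpoly P) (rlift t) = (pev n P t)%:C.
Proof. by case: t => [x|] /=; rewrite /cpoly ?horner_map ?coef_map. Qed.

Lemma horner_cpoly P x : (cpoly P).[x%:C] = P.[x]%:C.
Proof. exact: (pev_cpoly 0 P (Some x)). Qed.

Lemma normc_real x : `|x%:C| = `|x|%:C.
Proof. by rewrite normc_def /= expr0n addr0 sqrtr_sqr. Qed.

Lemma Re_mul_real (z : C) x : complex.Re (z * x%:C) = complex.Re z * x.
Proof. by case: z => u v; rewrite /= mulr0 subr0. Qed.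

Lemma Re_div_real (z : C) x : complex.Re (z / x%:C) = complex.Re z / x.
Proof. by rewrite -fmorphV Re_mul_real. Qed.

Definition Re_poly (P : {poly C}) : {poly R} := \poly_(i < size P) complex.Re P`_i.

Lemma coef_Re_poly (P : {poly C}) i : (Re_poly P)`_i = complex.Re P`_i.
Proof. by rewrite coef_poly; case: ltnP => // /(nth_default 0)->. Qed.

Lemma pev_Re_poly n (P : {poly C}) t :
  pev n (Re_poly P) t = complex.Re (pev n P (rlift t)).
Proof.
case: t => [x|] /=; last exact: coef_Re_poly.
rewrite (horner_coef_wide _ (size_poly _ _)) horner_coef.
have Re_sum (I : finType) (F : I -> C) :
    complex.Re (\sum_i F i) = \sum_i complex.Re (F i).
  by apply: (big_morph (@complex.Re R)) => // -[? ?] [? ?].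
rewrite Re_sum; apply: eq_bigr => i _.
by rewrite coef_Re_poly -Re_mul_real rmorphXn.
Qed.

Lemma horner_Re_poly (P : {poly C}) x : (Re_poly P).[x] = complex.Re P.[x%:C].
Proof. exact: (pev_Re_poly 0 P (Some x)). Qed.

Lemma near_nonroot Q c : Q != 0 -> \forall x \near c^', Q.[x] != 0.
Proof.
move=> Q0; have [m [q]] := multiplicity_XsubC Q c; rewrite Q0 /= => qc ->.
have qn : \forall x \near c^', q.[x] != 0.
  by apply: nbhs_dnbhs; apply: cvgr_neq0 (@continuous_horner R q c) qc.
near=> x; rewrite hornerM horner_exp !hornerE mulf_neq0 //; first by near: x.
rewrite expf_neq0 // subr_eq0; near: x; exact: nbhs_dnbhs_neq.
Unshelve. all: by end_near. Qed.

Lemma near_nonroot_pinfty Q : Q != 0 -> \forall x \near +oo, Q.[x] != 0.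
Proof.
move=> Q0; near=> x; apply/eqP => /(polyrcf.cauchy_boundP Q0).
apply/negP; rewrite -leNgt; apply: le_trans (ler_norm _); apply: ltW.
by near: x; apply: nbhs_pinfty_gt; rewrite num_real.
Unshelve. all: by end_near. Qed.

Lemma near_nonroot_ninfty Q : Q != 0 -> \forall x \near -oo, Q.[x] != 0.
Proof.
move=> Q0; near=> x; apply/eqP => /(polyrcf.cauchy_boundP Q0).
apply/negP; rewrite -leNgt -normrN; apply: le_trans (ler_norm _).
rewrite lerNr; apply: ltW.
by near: x; apply: nbhs_ninfty_lt; rewrite num_real.
Unshelve. all: by end_near. Qed.

Lemma cvg_inv_pinfty : (fun x : R => x^-1) x @[x --> +oo] --> (0 : R).
Proof.
apply/cvgr0Pnorm_lt => e e0; near=> x.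
have xe : e^-1 < x by near: x; apply: nbhs_pinfty_gt; rewrite num_real.
have ei : 0 < e^-1 by rewrite invr_gt0.
have x0 : 0 < x by apply: lt_trans xe.
by rewrite normfV gtr0_norm // invf_plt ?posrE.
Unshelve. all: by end_near. Qed.

Lemma cvg_inv_ninfty : (fun x : R => x^-1) x @[x --> -oo] --> (0 : R).
Proof.
apply/cvgr0Pnorm_lt => e e0; near=> x.
have xe : x < - e^-1 by near: x; apply: nbhs_ninfty_lt; rewrite num_real.
have ei : 0 < e^-1 by rewrite invr_gt0.
have x0 : x < 0 by apply: lt_trans xe _; rewrite oppr_lt0.
by rewrite normfV ltr0_norm // invf_plt ?posrE ?oppr_gt0 // ltrNr.
Unshelve. all: by end_near. Qed.

(** The power [(c - x)^d] absorbs exactly the zero of [Q] at [c]; what remains is a continuous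
    quotient whose numerator vanishes there. It shows that a change of form vanishing at the base
    point leaves the objective unchanged. *)
Lemma cvg_form_ratio_finite P Q c d : Q != 0 -> mup c Q = d -> P.[c] = 0 ->
  (fun x : R => P.[x] / Q.[x] * (c - x) ^+ d) x @[x --> c^'] --> (0 : R).
Proof.
move=> Q0 mQ Pc; have [m [q]] := multiplicity_XsubC Q c; rewrite Q0 /= => qc QE.
have {mQ} md : m = d.
  by rewrite -mQ QE mupMr // mup_XsubCX eqxx.
have lim : (fun x : R => (-1) ^+ d * (P.[x] / q.[x])) x @[x --> c^'] --> (0 : R).
  rewrite -[X in _ --> X](mulr0 ((-1) ^+ d)).
  apply: cvgM; first exact: cvg_cst.
  rewrite -[X in _ --> X](mul0r (q.[c])^-1) -Pc; apply: cvgM.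
    by apply: cvg_within_filter; exact: continuous_horner.
  apply: cvgV; first exact: qc.
  by apply: cvg_within_filter; exact: continuous_horner.
apply: cvg_trans lim; apply: near_eq_cvg; near=> x.
have xc : x - c != 0.
  by rewrite subr_eq0; near: x; exact: nbhs_dnbhs_neq.
have qx : q.[x] != 0.
  near: x; apply: nbhs_dnbhs; apply: cvgr_neq0 (@continuous_horner R q c) qc.
rewrite QE hornerM horner_exp !hornerE md -[c - x]opprB [(- (x - c)) ^+ d]exprNn /=.
move: ((x - c) ^+ d) (expf_neq0 d xc) ((-1) ^+ d) => u u0 v.
by field; rewrite qx u0.
Unshelve. all: by end_near. Qed.

(** In the variable [1 / x] this becomes continuity at 0. Multiplying [Q] by [X^d] brings its degree
    to exactly [n], so its reversal does not vanish at 0, while that of [P] does. The filter is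
    abstract so as to serve both ends of the line. *)
Lemma cvg_form_ratio_infinite (A : set_system R) (FA : Filter A) P Q n d :
  (fun x : R => x^-1) x @[x --> A] --> (0 : R) -> (\forall x \near A, x != 0) ->
  Q != 0 -> (size Q + d = n.+1)%N -> (size P <= n)%N ->
  (fun x : R => P.[x] / Q.[x] * (x ^+ d)^-1) x @[x --> A] --> (0 : R).
Proof.
move=> inv0 A0 Q0 sQ sP; pose S := Q * 'X^d.
have sS : size S = n.+1 by rewrite size_Mmonic ?monicXn // size_polyXn addnS.
pose rev := pmob 0 1 1 0 n : {poly R} -> {poly R}.
have revE (T : {poly R}) x : (size T <= n.+1)%N -> x != 0 ->
    T.[x] = x ^+ n * (rev T).[x^-1].
  move=> sT x0; have /= -> := pev_pmob 0 1 1 0 (Some x^-1) sT.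
  rewrite mul1r addr0 invr_eq0 x0 /= mul0r add0r div1r invrK.
  by rewrite mulrA -exprMn divff // expr1n mul1r.
have rev0 (T : {poly R}) : (size T <= n.+1)%N -> (rev T).[0] = T`_n.
  move=> sT; have /= -> := pev_pmob 0 1 1 0 (Some 0) sT.
  by rewrite mulr0 addr0 eqxx /= mul0r add0r expr1n mul1r.
have S0 : (rev S).[0] != 0.
  rewrite rev0 ?sS // (_ : S`_n = lead_coef S); last by rewrite /lead_coef sS.
  by rewrite lead_coef_eq0 mulf_neq0 // -size_poly_gt0 size_polyXn.
have cvg_rev (T : {poly R}) : (fun x : R => (rev T).[x^-1]) x @[x --> A] --> (rev T).[0].
  by apply: continuous_cvg inv0; exact: continuous_horner.
have lim : (fun x : R => (rev P).[x^-1] / (rev S).[x^-1]) x @[x --> A] -->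
    (rev P).[0] / (rev S).[0].
  apply: cvgM; first exact: cvg_rev.
  by apply: cvgV => //; exact: cvg_rev.
have P0 : (rev P).[0] = 0 by rewrite rev0 ?nth_default // leqW.
rewrite P0 mul0r in lim.
apply: cvg_trans lim; apply: near_eq_cvg; near=> x.
have x0 : x != 0 by near: x.
have -> : P.[x] / Q.[x] * (x ^+ d)^-1 = P.[x] / S.[x].
  by rewrite /S hornerM hornerXn invfM mulrA.
by rewrite (revE P x) ?(leqW sP) // (revE S x) ?sS // invfM mulrACA divff ?expf_neq0 // mul1r.
Unshelve. all: by end_near. Qed.

End RealForms.

Lemma mup_cpoly (R : realType) (P : {poly R}) (c : R) :
  P != 0 -> mup c%:C (cpoly P) = mup c P.
Proof.
move=> P0; have [m [q]] := multiplicity_XsubC P c; rewrite P0 /= => qc ->.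
have qC : ~~ root (cpoly q) c%:C.
  rewrite rootE horner_cpoly; apply: contra qc => /eqP/(congr1 (@complex.Re R)) /= qc0.
  exact/rootP.
rewrite [cpoly _]rmorphM rmorphXn rmorphB /= map_polyX map_polyC.
by rewrite !mupMr // !mup_XsubCX !eqxx.
Qed.

(** * The form attached to the divisor *)

Section Divisor.
Variables (R : realType) (D : option R -> nat) (s : seq (option R)).
Local Notation C := R[i].
Hypotheses (us : uniq s) (supp : forall t, D t != 0%N -> t \in s).

(** Infinity contributes no factor: its multiplicity is the amount by which the degree falls short
    of that of the divisor. *)
Definition divpoly (r : seq (option R)) : {poly R} :=
  \prod_(t <- r) (if t is Some c then ('X - c%:P) ^+ D t else 1).

Lemma monic_divpoly r : divpoly r \is monic.
Proof. by apply: monic_prod => -[c|] _; rewrite ?monic1 // monic_exp ?monicXsubC. Qed.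

Let sum_at t0 : (\sum_(t <- s) (if t == t0 then D t else 0) = D t0)%N.
Proof.
have [t0s|t0s] := boolP (t0 \in s).
  by rewrite (bigD1_seq t0) //= eqxx big1 ?addn0 // => t /negbTE->.
have -> : D t0 = 0%N by apply/eqP; apply: contraNT t0s; apply: supp.
rewrite big_seq big1 // => t ts; case: eqP => // E.
by rewrite E (negbTE t0s) in ts.
Qed.

Lemma size_divpoly : (size (divpoly s) + D None = (\sum_(t <- s) D t).+1)%N.
Proof.
rewrite -(sum_at None) /divpoly; elim: (s) => [|t r IH].
  by rewrite !big_nil size_poly1.
rewrite !big_cons; case: t => [c|] /=; last by rewrite mul1r addnCA IH addnS.
rewrite mulrC size_Mmonic ?monic_exp ?monicXsubC //; last first.
  by rewrite monic_neq0 // monic_divpoly.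
rewrite size_exp_XsubC addnS /= add0n addnAC IH addSn addnC //.
Qed.

Lemma mup_divpoly w : mup w (cpoly (divpoly s)) = extD D (Some w).
Proof.
have -> : mup w (cpoly (divpoly s)) =
    (\sum_(t <- s) (if rlift t == Some w then D t else 0))%N.
  rewrite /divpoly /cpoly; elim: (s) => [|t r IH].
    by rewrite !big_nil rmorph1 mupNroot // root1.
  rewrite !big_cons rmorphM /= mupM; last 2 first.
  - rewrite map_poly_eq0; case: t => [c|]; last exact: oner_neq0.
    by rewrite expf_neq0 // polyXsubC_eq0.
  - by rewrite map_poly_eq0 monic_neq0 // monic_divpoly.
  rewrite IH; congr addn; case: t => [c|] /=; last by rewrite rmorph1 mupNroot // root1.
  rewrite rmorphXn rmorphB /= map_polyX map_polyC mup_XsubCX.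
  by congr (if _ then _ else _); apply/eqP/eqP => [<-//|[]].
rewrite /extD; case: w => u v /=; case: eqP => [->|v0].
  rewrite -(sum_at (Some u)); apply: eq_bigr => t _; congr (if _ then _ else _).
  by case: t => [c|] //; apply/eqP/eqP => [[->]|[->]].
by rewrite big1 // => -[c|] _ //; case: eqP => // -[_ E]; case: v0.
Qed.

Lemma pev_divpoly n t : (\sum_(t <- s) D t)%N = n ->
  (pev n (divpoly s) t == 0) = (0 < D t)%N.
Proof.
move=> Dn; have mon := monic_divpoly s; have Q0 := monic_neq0 mon.
case: t => [c|] /=.
  have := mup_divpoly c%:C; rewrite /= eqxx => <-.
  rewrite -XsubC_dvd ?map_poly_eq0 // dvdp_XsubCl rootE horner_cpoly.
  by apply/eqP/eqP => [->//|[]].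
have := size_divpoly; rewrite Dn => sz.
case: (posnP (D None)) => [d0|d0].
  have -> : n = (size (divpoly s)).-1 by rewrite d0 addn0 in sz; rewrite sz.
  by rewrite -lead_coefE (monicP mon) oner_eq0.
by rewrite nth_default ?eqxx // -ltnS -sz -addn1 leq_add2l.
Qed.

End Divisor.

(** * Realness and uniqueness of the extremal form *)

Section ExtremalForm.
Variable R : realType.
Local Notation C := R[i].
Local Notation num := Defs.num.

Lemma rfun_forms (f : ratf R) (g P : {poly C}) (Q : {poly R}) (x : R) :
  num f * g = P -> den f * g = cpoly Q -> Q.[x] != 0 ->
  rfun f x = P.[x%:C] / (Q.[x])%:C.
Proof.
move=> <- fQ Qx; rewrite -horner_cpoly -fQ /rfun !hornerM.
have : (den f * g).[x%:C] != 0.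
  rewrite fQ horner_cpoly; apply/eqP => /(congr1 (@complex.Re R)) /= Qx0.
  by rewrite Qx0 eqxx in Qx.
by rewrite hornerM mulf_eq0 negb_or => /andP[d0 gx]; field; rewrite gx d0.
Qed.

(** As [Q] is real, the real part of [f] at a real point is [Re P / Q], so the two objectives differ
    by a term tending to 0. *)
Lemma objective_shift (A : set_system R) (FA : Filter A) (f f' : ratf R)
  (g g' P : {poly C}) (P' Q : {poly R}) (k : R -> R) (l : R) :
  num f * g = P -> den f * g = cpoly Q ->
  num f' * g' = cpoly P' -> den f' * g' = cpoly Q ->
  (\forall x \near A, Q.[x] != 0) ->
  (fun x => (P' - Re_poly P).[x] / Q.[x] * k x) x @[x --> A] --> 0 ->
  (fun x => complex.Re (rfun f x * (k x)%:C)) x @[x --> A] --> l ->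
  (fun x => complex.Re (rfun f' x * (k x)%:C)) x @[x --> A] --> l.
Proof.
move=> fP fQ f'P f'Q Qn lim0 liml.
have lim : (fun x => complex.Re (rfun f x * (k x)%:C) +
    (P' - Re_poly P).[x] / Q.[x] * k x) x @[x --> A] --> l.
  by rewrite -[X in _ --> X]addr0; apply: cvgD.
apply: cvg_trans lim; apply: near_eq_cvg; near=> x.
have Qx : Q.[x] != 0 by near: x.
rewrite /= (rfun_forms fP fQ Qx) (rfun_forms f'P f'Q Qx) !Re_mul_real !Re_div_real.
by rewrite horner_cpoly hornerD hornerN horner_Re_poly /= -mulrDl -mulrDl addrC subrK.
Unshelve. all: by end_near. Qed.

Variables (E : set (option R)) (n : nat) (D : option R -> nat) (xs : option R).
Variables (F : ratf R) (s : seq (option R)).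
Hypotheses (us : uniq s) (supp : forall t, D t != 0%N -> t \in s).
Hypothesis Dn : (\sum_(t <- s) D t)%N = n.
Hypothesis DE : forall t, D t != 0%N -> ~ E t.
Hypotheses (FD : inL D F) (FE : sup_le1 E F).
Let Q := divpoly D s.

Let Q0 : cpoly Q != 0.
Proof. by rewrite map_poly_eq0 monic_neq0 // monic_divpoly. Qed.

Let sQ : (size Q + D None = n.+1)%N.
Proof. by rewrite size_divpoly // Dn. Qed.

Let sQc : (size (cpoly Q) <= n.+1)%N.
Proof. by rewrite size_map_poly -sQ leq_addr. Qed.

Let QE t : E t -> pev n (cpoly Q) (rlift t) != 0.
Proof.
move=> Et; rewrite pev_cpoly; apply/eqP => /(congr1 (@complex.Re R))/eqP; rewrite /= pev_divpoly //.
by rewrite lt0n => /DE.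
Qed.

(** Cancelling common factors can only lower the pole orders, at infinity as well by a count of
    degrees; hence every real form dominated by [Q] on [E] gives an admissible function. *)
Let competitor (P' : {poly R}) : (size P' <= n.+1)%N ->
  (forall t, E t -> `|pev n P' t| <= `|pev n Q t|) ->
  exists (G : ratf R) g, [/\ num G * g = cpoly P', den G * g = cpoly Q,
    inL D G & sup_le1 E G].
Proof.
move=> sP' P'E; have [G [g [GP GQ]]] := ratf_of_polys (cpoly P') Q0.
have g0 : g != 0 by apply: contra_neq Q0; rewrite -GQ => ->; rewrite mulr0.
have sP'c : (size (cpoly P') <= n.+1)%N by rewrite size_map_poly.
exists G, g; split=> //.
  case=> [w|]; rewrite /poldiv.
    by rewrite -(mup_divpoly us supp) -/Q -GQ mupM ?den_neq0 ?leq_addr.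
  case: eqP => //= /eqP nG.
  have := sP'c; rewrite (size_num_mul GP g0 nG).
  have := sQ; rewrite -(size_map_poly (real_complex R)) -/(cpoly Q) (size_den_mul GQ g0).
  have : (0 < size g)%N by rewrite size_poly_gt0.
  have : (0 < size (den G))%N by rewrite size_poly_gt0 den_neq0.
  by move: (size _) (size _) (size _) (D None); lia.
move=> t Et; eexists; split; first exact: (reval_quotient GP GQ g0 sP'c sQc (QE Et)).
rewrite normf_div ler_pdivrMr ?normr_gt0 ?QE // mul1r !pev_cpoly !normc_real lecR.
exact: P'E.
Qed.

(** This is the reciprocal of [r(x, xs)^d]. *)
Let kernel (d : nat) (x : R) : R := if xs is Some c then (c - x) ^+ d else (x ^+ d)^-1.

(** The objective depends only on the real part of the value of the form at [xs]. *)
Let objlim_shift (G : ratf R) (g g' P : {poly C}) (P' : {poly R}) (l : R) :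
  num F * g = P -> den F * g = cpoly Q ->
  num G * g' = cpoly P' -> den G * g' = cpoly Q ->
  (size P <= n.+1)%N -> (size P' <= n.+1)%N ->
  pev n P' xs = complex.Re (pev n P (rlift xs)) ->
  objlim F xs (D xs) l -> objlim G xs (D xs) l.
Proof.
move=> FP FQ GP GQ sP sP' xsE.
pose r := P' - Re_poly P.
have Qn0 : Q != 0 by rewrite monic_neq0 // monic_divpoly.
have sr : (size r <= n.+1)%N.
  rewrite (leq_trans (size_polyD _ _)) // geq_max sP' size_polyN.
  by rewrite (leq_trans (size_poly _ _)).
have r0 : pev n r xs = 0.
  have -> : pev n r xs = pev n P' xs - pev n (Re_poly P) xs.
    by rewrite /r; case: (xs) => [c|] /=; rewrite !(hornerD, hornerN, coefB).
  by rewrite pev_Re_poly xsE subrr.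
have step (A : set_system R) (FA : Filter A) : (\forall x \near A, Q.[x] != 0) ->
    (fun x => r.[x] / Q.[x] * kernel (D xs) x) x @[x --> A] --> 0 ->
    (fun x => complex.Re (rfun F x * (kernel (D xs) x)%:C)) x @[x --> A] --> l ->
    (fun x => complex.Re (rfun G x * (kernel (D xs) x)%:C)) x @[x --> A] --> l.
  exact: objective_shift FP FQ GP GQ.
move: step r0; rewrite /kernel /objlim; case xsD: xs => [c|] step /= r0.
  have kE (f : ratf R) : (fun x : R => complex.Re (rfun f x * (c%:C - x%:C) ^+ D (Some c)))
      = (fun x : R => complex.Re (rfun f x * ((c - x) ^+ D (Some c))%:C)).
    by apply/funext => x; rewrite rmorphXn rmorphB.
  rewrite !kE; apply: step; first exact: near_nonroot.
  apply: cvg_form_ratio_finite => //.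
  by rewrite -mup_cpoly // mup_divpoly //= eqxx.
have kE (f : ratf R) : (fun x : R => complex.Re (rfun f x / x%:C ^+ D None))
    = (fun x : R => complex.Re (rfun f x * ((x ^+ D None)^-1)%:C)).
  by apply/funext => x; rewrite fmorphV rmorphXn.
have srn : (size r <= n)%N.
  rewrite -ltnS ltn_neqAle sr andbT; apply/eqP => srE.
  have : r == 0 by rewrite -lead_coef_eq0 /lead_coef srE r0.
  by rewrite -size_poly_eq0 srE.
rewrite !kE => -[lp lm]; split.
  apply: step lp; first exact: near_nonroot_pinfty.
  apply: cvg_form_ratio_infinite sQ srn => //; first exact: cvg_inv_pinfty.
  near=> x; apply: lt0r_neq0; near: x; exact: nbhs_pinfty_gt.
apply: step lm; first exact: near_nonroot_ninfty.
apply: cvg_form_ratio_infinite sQ srn => //; first exact: cvg_inv_ninfty.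
near=> x; apply: ltr0_neq0; near: x; exact: nbhs_ninfty_lt.
Unshelve. all: by end_near. Qed.

Hypothesis extr : exists lF : R, objlim F xs (D xs) lF /\
  forall (G : ratf R) (lG : R), inL D G -> sup_le1 E G -> objlim G xs (D xs) lG ->
    lG <= lF /\ (lG = lF -> G = F).

(** The real part of the form of [F] is again a competitor with the same objective, so by uniqueness
    it is the form itself. The last clause restates uniqueness for real forms with a fixed value at
    [xs]. *)
Lemma extremal_form : exists P g, [/\ num F * g = cpoly P, den F * g = cpoly Q,
  (size P <= n.+1)%N, (forall t, E t -> `|pev n P t| <= `|pev n Q t|) &
  forall P' : {poly R}, (size P' <= n.+1)%N ->
    (forall t, E t -> `|pev n P' t| <= `|pev n Q t|) ->
    pev n P' xs = pev n P xs -> P' = P].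
Proof.
have [g FQ] : exists g, den F * g = cpoly Q.
  have /dvdpP[g gE] : den F %| cpoly Q.
    apply: dvdp_of_mup_le => //; first exact: ratf_monic.
    by move=> w; rewrite mup_divpoly //; apply: (FD (Some w)).
  by exists g; rewrite mulrC.
have g0 : g != 0 by apply: contra_neq Q0; rewrite -FQ => ->; rewrite mulr0.
pose P := num F * g.
have sP : (size P <= n.+1)%N.
  have [nF0|nF0] := eqVneq (num F) 0; first by rewrite /P nF0 mul0r size_poly0.
  rewrite (size_num_mul (erefl P) g0 nF0).
  have := FD None; rewrite /= nF0.
  have := sQ; rewrite -(size_map_poly (real_complex R)) -/(cpoly Q) (size_den_mul FQ g0).
  have : (0 < size g)%N by rewrite size_poly_gt0.
  have : (0 < size (den F))%N by rewrite size_poly_gt0 den_neq0.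
  by move: (size _) (size _) (size _) (D None); lia.
have uniq (P' : {poly R}) : (size P' <= n.+1)%N ->
    (forall t, E t -> `|pev n P' t| <= `|pev n Q t|) ->
    pev n P' xs = complex.Re (pev n P (rlift xs)) -> cpoly P' = P.
  move=> sP' P'E xsE; have [G [g' [GP GQ GD GE]]] := competitor sP' P'E.
  have [lF [limF max]] := extr.
  have limG := objlim_shift (erefl P) FQ GP GQ sP sP' xsE limF.
  have [_ /(_ erefl) GF] := max G lF GD GE limG.
  (* The same function over the same [Q] has the same common factor [g], so the forms agree as
     well. *)
  rewrite -GP GF /P; congr (_ * _); apply: (mulfI (den_neq0 F)).
  by rewrite FQ -GQ GF.
have PE t : E t -> `|pev n P (rlift t)| <= `|pev n (cpoly Q) (rlift t)|.
  move=> Et; have [w [Fw w1]] := FE Et.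
  have /eqP := reval_pev (erefl P) FQ g0 sP sQc Fw.
  have -> : pev n (P - w *: cpoly Q) (rlift t) =
      pev n P (rlift t) - w * pev n (cpoly Q) (rlift t).
    by case: (t) => [c|] /=; rewrite !(hornerD, hornerN, hornerZ, coefB, coefZ).
  by rewrite subr_eq0 => /eqP->; rewrite normrM ler_piMl.
have PRe : cpoly (Re_poly P) = P.
  apply: uniq; last exact: pev_Re_poly.
    by apply: leq_trans sP; apply: size_poly.
  move=> t Et; rewrite pev_Re_poly -lecR; apply: le_trans (normc_ge_Re _) _.
  by rewrite -normc_real -pev_cpoly; apply: PE.
exists (Re_poly P), g; split; rewrite ?PRe //.
- by rewrite (leq_trans (size_poly _ _)).
- by move=> t Et; rewrite -lecR -!normc_real -!pev_cpoly PRe PE.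
move=> P' sP' P'E xsE; apply: (map_inj_poly (@complexI R)) => //.
by rewrite -!/(cpoly _) PRe; apply: uniq => //; rewrite xsE pev_Re_poly.
Qed.

End ExtremalForm.

(** * Charts sending a point outside [E] to infinity *)

Section Charts.
Variable R : realType.
Implicit Types (a b c d u v x y : R) (t : option R).

Lemma closed_preimage_of_near (E : set (option R)) (phi : R -> option R) :
  (forall y, ~ E (phi y) -> \forall z \near y, ~ E (phi z)) ->
  closed [set y | E (phi y)].
Proof.
move=> h; rewrite -[X in closed X]setCK; apply: open_closedC.
by rewrite openE => y; apply: h.
Qed.

(** [E] misses a neighbourhood of [t0], so it is bounded in a chart with [t0] at infinity. For
    finite [t0 = c] the chart is [y -> c - 1 / y]. *)
Lemma chart_at (E : set (option R)) t0 : ext_compact E -> ~ E t0 ->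
  exists a b c d, [/\ a * d - b * c = 1, mob a b c d None = t0,
    closed [set y : R | E (mob a b c d (Some y))] &
    exists M, forall y, E (mob a b c d (Some y)) -> `|y| <= M].
Proof.
move=> [clE bdE]; case: t0 => [c|] Et0; last first.
  exists 1, 0, 0, 1.
  have E1 y : mob 1 0 0 1 (Some y) = Some y.
    by rewrite /= mul0r add0r oner_eq0 /= mul1r addr0 divr1.
  split; rewrite /= ?eqxx //; first by ring.
    by under eq_set do rewrite -/(mob 1 0 0 1 (Some _)) E1.
  have [M MP] := bdE Et0; exists M => y.
  by rewrite -/(mob 1 0 0 1 (Some _)) E1; apply: MP.
exists c, (-1), 1, 0.
have E1 y : mob c (-1) 1 0 (Some y) = if y == 0 then None else Some (c - y^-1).
  rewrite /= mul1r addr0; have [//|y0] := eqVneq y 0.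
  by congr Some; field.
split.
- by ring.
- by rewrite /= oner_eq0 divr1.
- apply: closed_preimage_of_near => y; rewrite E1; case: eqP => [->|/eqP y0] nE.
    (* The coordinate 0 is the point at infinity. For [|z| < 1 / K] the point [c - 1 / z] has
       modulus above the bound [M] of the finite part of [E]. *)
    have [M MP] := bdE nE; pose K : R := `|M| + `|c| + 1.
    have K0 : 0 < K by rewrite /K; have := normr_ge0 M; have := normr_ge0 c; lra.
    near=> z; rewrite E1; case: eqP => [//|/eqP z0] /MP zM.
    have zK : `|z| < K^-1.
      by near: z; apply: (@nbhs0_lt R R); rewrite invr_gt0.
    have : `|z^-1| <= `|M| + `|c|.
      have zE : z^-1 = c - (c - z^-1) by rewrite opprB addrC subrK.
      rewrite {1}zE; apply: le_trans (ler_normB _ _) _; have := ler_norm M; lra.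
    rewrite normfV; have : K < `|z|^-1.
      by rewrite -[K]invrK ltf_pV2 ?posrE ?invr_gt0 ?normr_gt0.
    by rewrite /K; lra.
  have cont : (fun z => c - z^-1) z @[z --> y] --> c - y^-1.
    by apply: cvgB; [exact: cvg_cst|apply: cvgV].
  have opE : open (~` [set x | E (Some x)]) by apply: closed_openC.
  have nb : nbhs (c - y^-1) (~` [set x | E (Some x)]) by apply: open_nbhs_nbhs.
  near=> z; rewrite E1.
  have -> : (z == 0) = false by apply/negbTE; near: z; exact: (cvgr_neq0 y cvg_id y0).
  by near: z; apply: cont nb.
- have opE : open (~` [set x | E (Some x)]) by apply: closed_openC.
  have /nbhs_ballP[e /= e0 eP] : nbhs c (~` [set x | E (Some x)]).
    exact: open_nbhs_nbhs.
  exists e^-1 => y; rewrite -/(mob c (-1) 1 0 (Some y)) E1; case: eqP => [->|/eqP y0 Ey].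
    by rewrite normr0 invr_ge0 ltW.
  have : e <= `|y|^-1.
    rewrite leNgt; apply/negP => ye; apply: (eP (c - y^-1)) Ey.
    by rewrite /ball /= opprB addrC subrK normfV.
  by rewrite -{1}[e]invrK lef_pV2 ?posrE ?invr_gt0 ?normr_gt0.
Unshelve. all: by end_near. Qed.

Lemma closed_bounded_compact (A : set R) M :
  closed A -> (forall y, A y -> `|y| <= M) -> compact A.
Proof.
move=> cA AM; apply: subclosed_compact cA (@segment_compact R (- M) M) _ => y Ay.
by rewrite /= in_itv /= -ler_norml AM.
Qed.

End Charts.

(** * The four shapes: exclusivity, recognition and invariance *)

Section Shapes.
Variable R : realType.
Implicit Types (a b u v x y : R) (t : option R) (J : set (option R)).

Lemma citv_lt a b t : a < b ->
  citv (Some a) (Some b) t <-> exists2 y, t = Some y & a <= y <= b.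
Proof.
move=> ab; rewrite /citv oitv_lt //; split=> [[[y -> yab]|[->|->]]|[y -> /andP[]]].
- by exists y => //; move: yab => /andP[/ltW-> /ltW->].
- by exists a => //; rewrite lexx ltW.
- by exists b => //; rewrite lexx ltW.
rewrite !le_eqVlt => /orP[/eqP<- _|ay /orP[/eqP->|yb]]; first by right; left.
  by right; right.
by left; exists y => //; rewrite ay.
Qed.

(** Endpoints are arbitrary because this serves arcs through infinity; any of the other shapes would
    put a point of the open arc in [J]. *)
Lemma shape1_exclusive J (a b : option R) : shape1 J a b -> (exists t, oitv a b t) ->
  exactly_one4 (shape1 J a b) (shape2 J a b) (shape3 J a b) (shape4 J a b).
Proof.
move=> s1 [t tab].
have noJ t' : oitv a b t' -> ~ J t'.
  by move=> [at' t'b _ _] /s1[tE|tE]; [apply: at'|apply: t'b].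
constructor 1; split=> //.
- move=> [[v [vab h]]|[u [uab h]]]; first apply: (noJ v vab).
    by apply/h; left; right; right.
  by apply: (noJ u uab); apply/h; right; right; left.
- move=> [u [v [uv sub h]]]; have cu : citv u v u by right; left.
  by apply: (noJ u (sub u cu)); apply/h; constructor 3.
- by move=> h; apply: (noJ t tab); apply/h; left.
Qed.

Section Interval.
Variables (J : set (option R)) (a b : R).
Hypothesis ab : a < b.
(** The shapes are told apart by the behaviour of [J] next to the two ends; the first and third
    agree there and are separated by an interior point. *)
Let full_left := exists2 d, a < d & forall y, a < y < d -> J (Some y).
Let empty_left := exists2 d, a < d & forall y, a < y < d -> ~ J (Some y).
Let full_right := exists2 d, d < b & forall y, d < y < b -> J (Some y).
Let empty_right := exists2 d, d < b & forall y, d < y < b -> ~ J (Some y).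

Let left_excl : full_left -> empty_left -> False.
Proof.
move=> [d ad h] [d' ad' h']; pose y := (a + Num.min d d') / 2.
have yd : a < y < Num.min d d'.
  by rewrite /y; case: (leP d d') => dd'; apply/andP; split; lra.
move: yd; rewrite lt_min => /and3P[ay yd yd'].
by apply: (h' y); [rewrite ay|apply: h; rewrite ay].
Qed.

Let right_excl : full_right -> empty_right -> False.
Proof.
move=> [d ad h] [d' ad' h']; pose y := (b + Num.max d d') / 2.
have yd : Num.max d d' < y < b.
  by rewrite /y; case: (leP d d') => dd'; apply/andP; split; lra.
move: yd; rewrite gt_max => /andP[/andP[dy d'y] yb].
by apply: (h' y); [rewrite d'y|apply: h; rewrite dy].
Qed.

Let shape1P : shape1 J (Some a) (Some b) ->
  [/\ empty_left, empty_right & forall y, a < y < b -> ~ J (Some y)].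
Proof.
move=> h; have no y : a < y < b -> ~ J (Some y).
  by move=> yab /h[[E]|[E]]; rewrite E ltxx ?andbF in yab.
by split=> //; [exists b|exists a].
Qed.

Let shape2P : shape2 J (Some a) (Some b) ->
  full_left /\ empty_right \/ empty_left /\ full_right.
Proof.
move=> [[v [/(oitv_lt _ ab)[v0 -> /andP[av vb]] h]]|
        [u [/(oitv_lt _ ab)[u0 -> /andP[au ub]] h]]]; [left|right]; split.
- exists v0 => // y yav; apply/h; left; apply/citv_lt => //; exists y => //.
  by move: yav => /andP[/ltW-> /ltW->].
- exists v0 => // y /andP[vy yb] /h[/(citv_lt _ av)[_ [<-]]|[E]]; lra.
- exists u0 => // y /andP[vy yb] /h[[E]|/(citv_lt _ ub)[_ [<-]]]; lra.
- exists u0 => // y yav; apply/h; right; apply/citv_lt => //; exists y => //.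
  by move: yav => /andP[/ltW-> /ltW->].
Qed.

Let shape3P : shape3 J (Some a) (Some b) ->
  [/\ empty_left, empty_right & exists2 y, a < y < b & J (Some y)].
Proof.
move=> [u [v [uv sub h]]].
have /sub/(oitv_lt _ ab)[u0 uE /andP[au ub]] : citv u v u by right; left.
have /sub/(oitv_lt _ ab)[v0 vE /andP[av vb]] : citv u v v by right; right.
subst u v.
have {}uv : u0 < v0.
  rewrite lt_neqAle; apply/andP; split; first by apply/eqP => E; rewrite E in uv.
  (* For [v0 < u0] the arc from [u] to [v] would contain infinity, which is not in the gap. *)
  rewrite leNgt; apply/negP => vu.
  have /sub/(oitv_lt _ ab)[y] // : citv (Some u0) (Some v0) None.
  by left; apply/oitv_gt.
split.
- exists u0 => // y /andP[ay yu] /h[[E]|[E]|/(citv_lt _ uv)[_ [<-]]]; lra.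
- exists v0 => // y /andP[ay yu] /h[[E]|[E]|/(citv_lt _ uv)[_ [<-]]]; lra.
- exists u0; first by rewrite au.
  by apply/h; constructor 3; right; left.
Qed.

Let shape4P : shape4 J (Some a) (Some b) ->
  [/\ full_left, full_right & exists2 y, a < y < b & J (Some y)].
Proof.
move=> h; have fl y : a < y < b -> J (Some y).
  move=> /andP[/ltW ay /ltW yb]; apply/h/citv_lt => //; exists y => //.
  by rewrite ay yb.
split; [by exists b|by exists a|exists ((a + b) / 2)]; last apply: fl.
  by rewrite !midf_lt.
by rewrite !midf_lt.
Qed.

Lemma interval_shape_exclusive :
  [\/ shape1 J (Some a) (Some b), shape2 J (Some a) (Some b),
      shape3 J (Some a) (Some b) | shape4 J (Some a) (Some b)] ->
  exactly_one4 (shape1 J (Some a) (Some b)) (shape2 J (Some a) (Some b))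
    (shape3 J (Some a) (Some b)) (shape4 J (Some a) (Some b)).
Proof.
have n12 : shape1 J (Some a) (Some b) -> shape2 J (Some a) (Some b) -> False.
  by move=> /shape1P[el er _] /shape2P[[fl _]|[_ fr]];
    [apply: left_excl fl el|apply: right_excl fr er].
have n13 : shape1 J (Some a) (Some b) -> shape3 J (Some a) (Some b) -> False.
  by move=> /shape1P[_ _ no] /shape3P[_ _ [y /no]].
have n14 : shape1 J (Some a) (Some b) -> shape4 J (Some a) (Some b) -> False.
  by move=> /shape1P[_ _ no] /shape4P[_ _ [y /no]].
have n23 : shape2 J (Some a) (Some b) -> shape3 J (Some a) (Some b) -> False.
  by move=> /shape2P[[fl _]|[_ fr]] /shape3P[el er _];
    [apply: left_excl fl el|apply: right_excl fr er].
have n24 : shape2 J (Some a) (Some b) -> shape4 J (Some a) (Some b) -> False.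
  by move=> /shape2P[[_ er]|[el _]] /shape4P[fl fr _];
    [apply: right_excl fr er|apply: left_excl fl el].
have n34 : shape3 J (Some a) (Some b) -> shape4 J (Some a) (Some b) -> False.
  by move=> /shape3P[el _ _] /shape4P[fl _ _]; apply: left_excl fl el.
case=> h; [constructor 1|constructor 2|constructor 3|constructor 4]; split=> //;
  by [move/n12; apply|move/n13; apply|move/n14; apply|move/n23; apply|
      move/n24; apply|move/n34; apply|move=> ?; eauto].
Qed.

(** Once the band meets the gap, the comparisons of [u] with [a] and of [v] with [b] select the
    shape. The condition on [u = v] excludes an isolated interior point, which no shape allows. *)
Lemma band_shapes u v : u <= v -> (u = v -> ~ a < u < b) ->
  (forall t, J t <-> exists y, t = Some y /\
     [\/ y = a, y = b | (a < y < b) && (u <= y <= v)]) ->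
  exactly_one4 (shape1 J (Some a) (Some b)) (shape2 J (Some a) (Some b))
    (shape3 J (Some a) (Some b)) (shape4 J (Some a) (Some b)).
Proof.
move=> uv uvE JP; apply: interval_shape_exclusive.
have [empty|] := pselect (forall y, ~ ((a < y < b) && (u <= y <= v))).
  constructor 1 => t; rewrite JP; split=> [[y [-> [->|->|/empty//]]]|[->|->]].
  - by left.
  - by right.
  - by exists a; split=> //; constructor 1.
  - by exists b; split=> //; constructor 2.
move=> /existsNP[y0 /contrapT /andP[/andP[ay0 y0b] /andP[uy0 y0v]]].
have {uvE} uv' : u < v.
  rewrite lt_neqAle uv andbT; apply/eqP => E; apply: uvE (E) _.
  have -> : u = y0 by apply/eqP; rewrite eq_le uy0 E y0v.
  by rewrite ay0.
have [ua|au] := leP u a; have [bv|vb] := leP b v.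
- constructor 4 => t; rewrite JP citv_lt //; split=> [[y [-> h]]|[y -> h]].
    by exists y => //; case: h => [->|->|]; lra.
  exists y; split=> //; have [->|ya] := eqVneq y a; first by constructor 1.
  have [->|yb] := eqVneq y b; first by constructor 2.
  move: h => /andP[ay' yb']; constructor 3.
  have ay : a < y by rewrite lt_neqAle eq_sym ya.
  by have {}yb : y < b; [rewrite lt_neqAle yb|lra].
- constructor 2; left; exists (Some v); split.
    by apply/oitv_lt => //; exists v => //; lra.
  move=> t; rewrite JP citv_lt; last lra.
  split=> [[y [-> h]]|].
    case: h => [->|->|h]; [left; exists a => //; lra|by right|left; exists y => //; lra].
  case=> [[y -> h]|->]; last by exists b; split=> //; constructor 2.
  exists y; split=> //; have [->|ya] := eqVneq y a; first by constructor 1.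
  move: h => /andP[ay' yv]; constructor 3.
  by have ay : a < y; [rewrite lt_neqAle eq_sym ya|lra].
- constructor 2; right; exists (Some u); split.
    by apply/oitv_lt => //; exists u => //; lra.
  move=> t; rewrite JP citv_lt; last lra.
  split=> [[y [-> h]]|].
    case: h => [->|->|h]; [by left|right; exists b => //; lra|right; exists y => //; lra].
  case=> [->|[y -> h]]; first by exists a; split=> //; constructor 1.
  exists y; split=> //; have [->|yb] := eqVneq y b; first by constructor 2.
  move: h => /andP[uy yb']; constructor 3.
  by have {}yb : y < b; [rewrite lt_neqAle yb|lra].
- constructor 3; exists (Some u), (Some v); split.
  + by move=> [E]; rewrite E ltxx in uv'.
  + by move=> t /(citv_lt _ uv')[y -> h]; apply/oitv_lt => //; exists y => //; lra.
  move=> t; rewrite JP; split=> [[y [-> h]]|].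
    case: h => [->|->|h]; [by constructor 1|by constructor 2|constructor 3].
    by apply/citv_lt => //; exists y => //; lra.
  case=> [->|->|/(citv_lt _ uv')[y -> h]].
  + by exists a; split=> //; constructor 1.
  + by exists b; split=> //; constructor 2.
  + by exists y; split=> //; constructor 3; lra.
Qed.

End Interval.

Section Transport.
Variables (ma mb mc md : R).
Hypothesis det : ma * md - mb * mc = 1.
Let psi := mob ma mb mc md.

Lemma mob_preimage t : exists t', t = psi t'.
Proof.
exists (mob md (- mb) (- mc) ma t).
have det' : md * ma - - mb * - mc = 1 by rewrite -det; ring.
by have := mobK t det'; rewrite !opprK.
Qed.

Lemma oitv_mob t0 t1 t : oitv (psi t0) (psi t1) (psi t) = oitv t0 t1 t.
Proof. by apply/propext; apply: cyc_mob. Qed.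

Lemma eq_mob t t' : (psi t = psi t') = (t = t').
Proof. by apply/propext; split=> [/(mob_inj det)|->]. Qed.

Lemma citv_mob t0 t1 t : citv (psi t0) (psi t1) (psi t) = citv t0 t1 t.
Proof. by rewrite /citv oitv_mob !eq_mob. Qed.

(** A Moebius map is a bijection, so quantifiers over points can be moved to the chart; this carries
    over the four shapes. *)
Let forall_mob (P : option R -> Prop) : (forall t, P t) = (forall t, P (psi t)).
Proof.
by apply/propext; split=> // h t; have [t' ->] := mob_preimage t.
Qed.

Let exists_mob (P : option R -> Prop) : (exists t, P t) = (exists t, P (psi t)).
Proof.
apply/propext; split=> [[t]|[t h]]; last by exists (psi t).
by have [t' ->] := mob_preimage t; exists t'.
Qed.

Lemma shape1_mob J t0 t1 : shape1 J (psi t0) (psi t1) = shape1 (J \o psi) t0 t1.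
Proof.
by rewrite /shape1 [LHS]forall_mob; apply: eq_forall => t; rewrite !eq_mob.
Qed.

Lemma shape2_mob J t0 t1 : shape2 J (psi t0) (psi t1) = shape2 (J \o psi) t0 t1.
Proof.
congr (_ \/ _); rewrite [LHS]exists_mob; apply: eq_exists => v;
  rewrite oitv_mob; congr (_ /\ _); rewrite [LHS]forall_mob;
  by apply: eq_forall => t; rewrite citv_mob eq_mob.
Qed.

Lemma shape3_mob J t0 t1 : shape3 J (psi t0) (psi t1) = shape3 (J \o psi) t0 t1.
Proof.
rewrite /shape3 [LHS]exists_mob; apply: eq_exists => u.
rewrite [LHS]exists_mob; apply: eq_exists => v.
congr (and3 _ _ _); first by rewrite eq_mob.
  by rewrite [LHS]forall_mob; apply: eq_forall => t; rewrite citv_mob oitv_mob.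
by rewrite [LHS]forall_mob; apply: eq_forall => t; rewrite citv_mob !eq_mob.
Qed.

Lemma shape4_mob J t0 t1 : shape4 J (psi t0) (psi t1) = shape4 (J \o psi) t0 t1.
Proof.
by rewrite /shape4 [LHS]forall_mob; apply: eq_forall => t; rewrite citv_mob.
Qed.

End Transport.

End Shapes.

(** * Zeros of the level polynomials over the complex sphere *)

Section LevelSets.
Variable R : realType.
Local Notation C := R[i].
Local Notation num := Defs.num.
Variables (F : ratf R) (n : nat) (P Q : {poly R}) (g : {poly C}).
Hypotheses (FP : num F * g = cpoly P) (FQ : den F * g = cpoly Q) (g0 : g != 0).
Hypotheses (sP : (size P <= n.+1)%N) (sQ : (size Q <= n.+1)%N).
Hypothesis nconst : ~ is_const F.

Definition unit_value (z : option C) :=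
  exists w, [/\ reval F z = Some w, complex.Im w = 0 & -1 <= complex.Re w <= 1].

Let sPc : (size (cpoly P) <= n.+1)%N. Proof. by rewrite size_map_poly. Qed.
Let sQc : (size (cpoly Q) <= n.+1)%N. Proof. by rewrite size_map_poly. Qed.

Lemma cpoly_level c : cpoly P - c%:C *: cpoly Q = cpoly (P - c *: Q).
Proof. by rewrite /cpoly rmorphB /= map_polyZ. Qed.

Lemma level_neq0 c : P - c *: Q != 0.
Proof.
apply/eqP => h; apply: nconst; apply: (@is_const_proportional R F c%:C).
apply: (mulIf g0); rewrite -scalerAl FP FQ; apply/eqP.
by rewrite -subr_eq0 cpoly_level h /cpoly rmorph0.
Qed.

Lemma size_level c : (size (P - c *: Q)%R <= n.+1)%N.
Proof.
rewrite (leq_trans (size_polyD _ _)) // geq_max sP size_polyN.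
by rewrite (leq_trans (size_scale_leq _ _)).
Qed.

Lemma unit_value_level z : unit_value z ->
  exists c, [/\ reval F z = Some c%:C, -1 <= c <= 1 & pev n (cpoly (P - c *: Q)) z = 0].
Proof.
move=> [[u v] [Fz /= v0 u1]]; rewrite {}v0 in Fz.
by exists u; split=> //; rewrite -cpoly_level; exact: (reval_pev FP FQ g0 sPc sQc Fz).
Qed.

Lemma unit_value_intro t : `|pev n P t| <= `|pev n Q t| -> pev n Q t != 0 ->
  unit_value (rlift t).
Proof.
move=> PQ Q0; exists (pev n P t / pev n Q t)%:C; split=> //=.
  rewrite (reval_quotient FP FQ g0 sPc sQc) !pev_cpoly.
    by rewrite fmorph_div.
  by apply/eqP => /(congr1 (@complex.Re R)) /= h; rewrite h eqxx in Q0.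
by rewrite -ler_norml normf_div ler_pdivrMr ?normr_gt0 // mul1r.
Qed.

(** The vanishing to order two is stated with a linear form [m], to treat finite points and infinity
    alike. The bound on [r] makes it a form of degree [n - 2]. *)
Lemma unit_value_common t : unit_value (rlift t) -> pev n Q t = 0 ->
  exists c m r, [/\ -1 <= c <= 1, P - c *: Q = m ^+ 2 * r,
    (size m <= 2)%N, ((size r).+1 <= n)%N & pev 1 m t = 0].
Proof.
move=> /unit_value_level[c [Ft c1 _]] Qt.
have := reval_pev_double FP FQ g0 sPc sQc Ft; rewrite pev_cpoly Qt => /(_ erefl).
case: t Ft Qt => [x|] _ _ /=; rewrite cpoly_level.
  move=> [r' E]; have : ('X - x%:P) ^+ 2 %| P - c *: Q.
    rewrite -(dvdp_map (real_complex R)) -/(cpoly (P - c *: Q)) E.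
    by rewrite rmorphXn rmorphB /= map_polyX map_polyC dvdp_mulr.
  move=> /dvdpP[r rE]; exists c, ('X - x%:P), r; split=> //.
  - by rewrite mulrC.
  - by rewrite size_XsubC.
  - have r0 : r != 0 by apply: contra_neq (level_neq0 c) => r0; rewrite rE r0 mul0r.
    have := size_level c.
    by rewrite rE size_Mmonic ?monic_exp ?monicXsubC // size_exp_XsubC addn3.
  - by rewrite /= !hornerE subrr.
(* As a form of degree one, the constant 1 is [Y], which vanishes at infinity. *)
rewrite size_map_poly => sz; exists c, 1, (P - c *: Q); split=> //.
- by rewrite expr1n mul1r.
- by rewrite size_poly1.
- have := level_neq0 c; rewrite -size_poly_gt0; move: sz.
  by move: (size _); lia.
- by rewrite /= coefC.
Qed.

(** A real level vanishing at [w] is divisible by the real quadratic with roots [w] and its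
    conjugate: the remainder is real, of degree at most one, with a nonreal root, hence zero. The
    quadratic is positive on the whole real line and at infinity. *)
Lemma unit_value_nonreal w : unit_value (Some w) -> complex.Im w != 0 ->
  exists c m r, [/\ -1 <= c <= 1, P - c *: Q = m * r, (size m <= 3)%N,
    ((size r).+1 <= n)%N & forall t, 0 < pev 2 m t].
Proof.
move=> /unit_value_level[c [_ c1 /= hw]]; case: w hw => u v hw /= v0.
pose m : {poly R} := ('X - u%:P) ^+ 2 + (v ^+ 2)%:P.
have sm : size m = 3%N.
  by rewrite size_polyDl size_exp_XsubC // size_polyC; case: (_ != 0).
have mw : (cpoly m).[u +i* v] = 0.
  rewrite /cpoly rmorphD rmorphXn rmorphB /= map_polyX !map_polyC /= !hornerE.
  by rewrite expr2; apply/eqP; rewrite eq_complex /=; apply/andP; split; apply/eqP; ring.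
have m0 : m != 0 by rewrite -size_poly_gt0 sm.
have := divp_eq (P - c *: Q) m; set r := (_ %/ m); set d := (_ %% m) => E.
have sd : (size d <= 2)%N by rewrite -ltnS -sm ltn_modp.
have dw : (cpoly d).[u +i* v] = 0.
  by move: hw; rewrite E /cpoly rmorphD rmorphM /= hornerD hornerM mw mulr0 add0r.
have d0 : d = 0.
  have dE : d = (d`_1) *: 'X + (d`_0)%:P.
    apply/polyP => -[|[|i]]; rewrite coefD coefZ coefX coefC /= ?mulr0 ?mulr1 ?add0r ?addr0 //.
    by rewrite nth_default // (leq_trans sd).
  move: dw; rewrite dE /cpoly rmorphD /= map_polyZ /= map_polyX map_polyC /= !hornerE.
  move=> /eqP; rewrite eq_complex /= !mul0r ?subr0 ?addr0 ?add0r => /andP[h1 h2].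
  have e1 : d`_1 = 0 by apply/eqP; move: h2; rewrite mulf_eq0 (negbTE v0) orbF.
  move: h1; rewrite e1 mul0r add0r => /eqP e0.
  by rewrite e0 scale0r add0r.
exists c, m, r; split=> //.
- by rewrite E d0 addr0 mulrC.
- by rewrite sm.
- have r0 : r != 0.
    by apply: contra_neq (level_neq0 c) => r0; rewrite E r0 d0 mul0r addr0.
  by have := size_level c; rewrite E d0 addr0 size_mul // sm addn3.
case=> [x|] /=; last first.
  have -> : m`_2 = lead_coef m by rewrite lead_coefE sm.
  rewrite lead_coefDl ?size_exp_XsubC ?size_polyC; last by case: (_ != 0).
  have /monicP-> // : ('X - u%:P) ^+ 2 \is monic by rewrite monic_exp ?monicXsubC.
rewrite /m !hornerE; have : 0 < v ^+ 2 by rewrite exprn_even_gt0.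
by have := sqr_ge0 (x - u); lra.
Qed.

End LevelSets.

(** The transform of [m] is linear with root [y], so it is a constant times [X - y]; the square of
    the constant goes into [r']. *)
Lemma pmob_square (R : realType) (a b c d : R) (n : nat) (m r : {poly R}) (y : R) :
  a * d - b * c = 1 -> (size m <= 2)%N -> ((size r).+1 <= n)%N -> r != 0 ->
  pev 1 m (mob a b c d (Some y)) = 0 ->
  exists2 r' : {poly R}, (size r' <= n)%N &
    pmob a b c d n (m ^+ 2 * r) = ('X - y%:P) ^+ 2 * r'.
Proof.
move=> det sm sr r0 my; rewrite -size_poly_gt0 in r0.
have [k nE] : exists k, n = (2 + k)%N by exists (n - 2)%N; lia.
have /factor_theorem[l lE] : root (pmob a b c d 1 m) y.
  by apply/rootP; have /= -> := pev_pmob a b c d (Some y) sm; rewrite my mulr0.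
have sl : (size l <= 1)%N.
  have [->|l0] := eqVneq l 0; first by rewrite size_poly0.
  have := size_pmob a b c d 1 m.
  by rewrite lE size_Mmonic ?monicXsubC // size_XsubC addn2.
exists (l`_0 ^+ 2 *: pmob a b c d k r).
  apply: leq_trans (size_scale_leq _ _) _; apply: leq_trans (size_pmob _ _ _ _ _ _) _.
  by rewrite nE.
have sm2 : (size (m ^+ 2)%R <= 3)%N.
  apply: leq_trans (size_poly_exp_leq _ _) _.
  by move: sm; move: (size m); lia.
rewrite nE pmobM //; last by lia.
have -> : pmob a b c d 2 (m ^+ 2) = pmob a b c d 1 m ^+ 2 by apply: pmobX.
rewrite lE {1}(size1_polyC sl).
by rewrite exprMn -polyC_exp mul_polyC -scalerAl scalerAr.
Qed.

(** If [P] did not vanish at [c], nothing would cancel there: the zero order would be 0 and the pole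
    order the full [D c], making the count 0. *)
Lemma common_zero_of_divisor (R : realType) (D : option R -> nat)
  (s : seq (option R)) (n : nat) (F : ratf R) (P : {poly R}) (g : {poly R[i]})
  (c : option R) :
  uniq s -> (forall t, D t != 0%N -> t \in s) -> (\sum_(t <- s) D t)%N = n ->
  Defs.num F * g = cpoly P -> den F * g = cpoly (divpoly D s) -> g != 0 ->
  (size P <= n.+1)%N -> (0 < D c)%N ->
  (zerdiv F (rlift c))%:Z + (extD D (rlift c))%:Z - (poldiv F (rlift c))%:Z = 1 ->
  pev n P c = 0.
Proof.
move=> us supp Dn FP FQ g0 sP Dc; apply: contra_eq => Pc.
have nF : Defs.num F != 0.
  apply: contra_neq Pc => nF; have P0 : P = 0.
    by apply/eqP; rewrite -(map_poly_eq0 (real_complex R)) -/(cpoly P) -FP nF mul0r.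
  by rewrite P0; case: (c) => [x|] /=; rewrite ?horner0 ?coef0.
suff [-> ->] : zerdiv F (rlift c) = 0%N /\ poldiv F (rlift c) = extD D (rlift c).
  by rewrite add0r subrr.
rewrite /zerdiv (negbTE nF); case: c Dc Pc => [x|] Dc Px /=.
  have : (cpoly P).[x%:C] != 0.
    rewrite horner_cpoly; apply/eqP => /(congr1 (@complex.Re R)) /= h.
    by rewrite /= h eqxx in Px.
  rewrite -FP hornerM mulf_eq0 negb_or => /andP[nx gx].
  have := mup_divpoly us supp x%:C; rewrite /= eqxx -FQ => <-.
  by rewrite mupNroot // mupMl.
have sPn : size P = n.+1.
  apply/eqP; rewrite eqn_leq sP ltnNge; apply: contra Px => /(nth_default 0) /= ->.
  by rewrite eqxx.
have := size_num_mul FP g0 nF; have := size_den_mul FQ g0.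
have := size_divpoly us supp; rewrite Dn /cpoly !size_map_poly sPn nF.
have : (0 < size g)%N by rewrite size_poly_gt0.
have : (0 < size (den F))%N by rewrite size_poly_gt0 den_neq0.
have : (0 < size (Defs.num F))%N by rewrite size_poly_gt0.
move: Dc; rewrite /=.
by move: (size _) (size _) (size _) (size _) (D None) => *; split; lia.
Qed.

(** * The trace of the extended set on the gaps *)

Theorem theorem2p9 (R : realType) (E : set (option R)) (n : nat)
  (D : option R -> nat) (xs : option R) (F : ratf R) :
  ext_compact E -> (exists t, ~ E t) -> infinite_set E ->
  (1 <= n)%N ->
  (exists s : seq (option R),
     [/\ uniq s, (forall t, D t != 0%N -> t \in s) & (\sum_(t <- s) D t)%N = n]) ->
  (forall t, D t != 0%N -> ~ E t) ->
  ~ E xs ->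
  inL D F -> sup_le1 E F ->
  (exists lF : R, objlim F xs (D xs) lF /\
     forall (G : ratf R) (lG : R), inL D G -> sup_le1 E G -> objlim G xs (D xs) lG ->
       lG <= lF /\ (lG = lF -> G = F)) ->
  ~ is_const F ->
  let En : set (option R[i]) := fun z =>
    exists w, [/\ reval F z = Some w, complex.Im w = 0 & -1 <= complex.Re w <= 1] in
  let D0 : option R -> int := fun c =>
    (zerdiv F (rlift c))%:Z + (extD D (rlift c))%:Z - (poldiv F (rlift c))%:Z in
  (forall t, E t -> En (rlift t)) /\
  (forall z, En z -> exists t, z = rlift t) /\
  (forall a b, gap E a b ->
     let J : set (option R) := fun t => En (rlift t) /\ citv a b t in
     [/\ exactly_one4 (shape1 J a b) (shape2 J a b) (shape3 J a b) (shape4 J a b),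
         oitv a b xs -> shape1 J a b &
         (exists c, [/\ oitv a b c, (0 < D c)%N & D0 c = 1]) -> shape1 J a b]).
Proof.
move=> cE _ _ n1 [s [us supp Dn]] DE xsE FD FE extr nconst En D0.
have [P [g [FP FQ sP PE uniqP]]] := extremal_form us supp Dn DE FD FE extr.
set Q := divpoly D s in FQ PE uniqP.
have Q0 : Q != 0 by rewrite monic_neq0 // monic_divpoly.
have sQD : (size Q + D None = n.+1)%N by rewrite size_divpoly // Dn.
have sQ : (size Q <= n.+1)%N by rewrite -sQD leq_addr.
have g0 : g != 0.
  apply: contra_neq Q0 => g0; apply/eqP.
  by rewrite -(map_poly_eq0 (real_complex R)) -/(cpoly Q) -FQ g0 mulr0.
have QD t : (pev n Q t == 0) = (0 < D t)%N by apply: pev_divpoly.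
have QE t : E t -> pev n Q t != 0 by move=> Et; rewrite QD lt0n; apply/negP => /DE.
have EEn t : E t -> En (rlift t).
  by move=> Et; apply: (unit_value_intro FP FQ g0 sP sQ); [apply: PE|apply: QE].
have lvl0 k : P - k *: Q != 0 by apply: level_neq0 FP FQ g0 nconst k.
have slvl k : (size (P - k *: Q)%R <= n.+1)%N by apply: size_level.
(* With [xs] at infinity in the chart, [E] becomes a compact subset of the line and the value at
   [xs] becomes, up to a nonzero weight, the coefficient of degree [n]. *)
have [a [b [c [d [det psi_xs clK [M KM]]]]]] := chart_at cE xsE.
pose psi := mob a b c d; pose lam := mob_weight a b c d.
have lam0 t : lam t ^+ n != 0 by rewrite expf_neq0 // mob_weight_neq0.
pose T := pmob a b c d n : {poly R} -> {poly R}.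
have TE (P' : {poly R}) t : (size P' <= n.+1)%N ->
    pev n (T P') t = lam t ^+ n * pev n P' (psi t) by apply: pev_pmob.
have TEy (P' : {poly R}) y : (size P' <= n.+1)%N ->
    (T P').[y] = lam (Some y) ^+ n * pev n P' (psi (Some y)) by exact: (@TE P' (Some y)).
have Tlvl k : T P - k *: T Q = T (P - k *: Q) by rewrite /T pmobB pmobZ.
have Tlvl0 k : T P - k *: T Q != 0.
  by rewrite Tlvl; apply: contra_neq (lvl0 k); apply: pmob_eq0.
have sTP : (size (T P) <= n.+1)%N by apply: size_pmob.
have sTQ : (size (T Q) <= n.+1)%N by apply: size_pmob.
pose K := [set y : R | E (psi (Some y))].
have psi_surj t : t != xs -> exists y, t = psi (Some y).
  move=> txs; have [[y|] tE] := mob_preimage det t; first by exists y.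
  by rewrite tE psi_xs eqxx in txs.
have E_psi t : E t -> exists2 y, t = psi (Some y) & K y.
  move=> Et; have [|y tE] := psi_surj t; last by exists y => //; rewrite tE in Et.
  by apply/eqP => tE; apply: xsE; rewrite -tE.
have [e [sq [szs srt sqK alt]]] : exists e sq, [/\ size sq = n.+1, sorted <%R sq,
    (forall x, x \in sq -> K x) &
    forall k, -1 <= k <= 1 -> alternates e sq (T P - k *: T Q)].
  apply: (extremal_alternation (K := K)) => //.
  - exact: closed_bounded_compact clK KM.
  - by exists (- M) => y /KM; rewrite ler_norml => /andP[].
  - by move=> y Ky; rewrite (TEy Q y sQ) mulf_neq0 // QE.
  - move=> y Ky; rewrite (TEy Q y sQ) (TEy P y sP).
    by rewrite !normrM ler_wpM2l // PE.
  (* A perturbation of degree less than [n] is pulled back to the original coordinate, where it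
     vanishes at [xs]; uniqueness of the extremal form then makes it zero. *)
  move=> r sr rK; pose r' := pmob d (- b) (- c) a n r.
  have sr1 : (size r <= n.+1)%N by apply: leqW.
  have det' : d * a - - b * - c = 1 by rewrite -det; ring.
  have Tr : T r' = r by rewrite -[RHS](pmobK det' sr1) !opprK.
  have sr' : (size r' <= n.+1)%N by apply: size_pmob.
  have sPr : (size (P - r')%R <= n.+1)%N.
    by rewrite (leq_trans (size_polyD _ _)) // geq_max sP size_polyN.
  have TPr : T (P - r') = T P - r by rewrite {1}/T pmobB -/(T P) -/(T r') Tr.
  have : P - r' = P.
    apply: uniqP => // [t Et|].
      have [y tE Ky] := E_psi t Et; rewrite tE.
      rewrite -(ler_pM2l (_ : 0 < `|lam (Some y) ^+ n|)) ?normr_gt0 //.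
      rewrite -!normrM -!TE // TPr; exact: rK.
    rewrite -psi_xs -/psi; apply: (mulfI (lam0 None)); rewrite -!TE // TPr /=.
    by rewrite coefB [r`_n]nth_default ?subr0.
  by move/eqP; rewrite -subr_eq0 addrAC subrr sub0r oppr_eq0 => /eqP r0;
    rewrite -Tr r0 /T /pmob big1 // => i _; rewrite coef0 scale0r.
pose EP y := En (rlift (psi (Some y))).
have En_level t : En (rlift (psi t)) ->
    exists2 k, -1 <= k <= 1 & pev n (T P - k *: T Q) t = 0.
  move=> /(unit_value_level FP FQ g0 sP sQ)[k [_ k1 hk]]; exists k => //.
  rewrite Tlvl TE //; move: hk; rewrite pev_cpoly => /(congr1 (@complex.Re R)) /= ->.
  by rewrite mulr0.
have factor_bound k m r : P - k *: Q = m * r -> r != 0.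
  by move=> E1; apply: contra_neq (lvl0 k) => r0; rewrite E1 r0 mulr0.
have EP_level y : EP y -> exists2 k, -1 <= k <= 1 & (T P - k *: T Q).[y] = 0.
  exact: (En_level (Some y)).
have EP_intro y : `|(T P).[y]| <= `|(T Q).[y]| ->
    ~ ((T P).[y] = 0 /\ (T Q).[y] = 0) -> EP y.
  rewrite (TEy Q y sQ) (TEy P y sP) => le nz.
  have le' : `|pev n P (psi (Some y))| <= `|pev n Q (psi (Some y))|.
    by move: le; rewrite !normrM ler_pM2l // normr_gt0.
  apply: (unit_value_intro FP FQ g0 sP sQ) => //; apply/eqP => q0.
  apply: nz; move: le'; rewrite q0 normr0 normr_le0 => /eqP->.
  by rewrite mulr0.
have EP_common y : EP y -> (T P).[y] = 0 -> (T Q).[y] = 0 ->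
    exists k (r : {poly R}), [/\ -1 <= k <= 1, (size r <= n)%N &
      T P - k *: T Q = ('X - y%:P) ^+ 2 * r].
  move=> EPy _; rewrite (TEy Q y sQ) => /eqP.
  rewrite mulf_eq0 (negbTE (lam0 _)) /= => /eqP q0.
  have [k [m [r [k1 mr sm sr my]]]] := unit_value_common FP FQ g0 sP sQ nconst EPy q0.
  have [r' sr' E1] := pmob_square det sm sr (factor_bound _ _ _ mr) my.
  by exists k, r'; split=> //; rewrite Tlvl mr.
split; first exact: EEn.
split.
  case=> [w|] Ez; last by exists None.
  have [w0|w0] := eqVneq (complex.Im w) 0.
    by exists (Some (complex.Re w)); case: w w0 {Ez} => u v /= ->.
  (* A nonreal point would give a level with a quadratic factor whose transform is positive at all
     the nodes. *)
  exfalso; have [k [m [r [k1 mr sm sr mpos]]]] :=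
    unit_value_nonreal FP FQ g0 sP sQ nconst Ez w0.
  have r0 := factor_bound _ _ _ mr; rewrite -size_poly_gt0 in r0.
  have [l nE] : exists l, n = (2 + l)%N by exists (n - 2)%N; lia.
  apply: (level_factor szs srt alt Tlvl0 k1 (m := pmob a b c d 2 m)
    (r := pmob a b c d l r)).
  - move=> y _; have /= -> := pev_pmob a b c d (Some y) sm.
    by rewrite mulr_gt0 // exprn_even_gt0 // orbC (mob_weight_neq0 (Some y) det).
  - by rewrite nE (leq_trans (size_pmob _ _ _ _ _ _)).
  - by rewrite Tlvl mr /T nE pmobM //; lia.
move=> a0 b0 [Ea Eb ab0 gapE] J.
have [al aE Kal] := E_psi _ Ea; have [be bE Kbe] := E_psi _ Eb.
rewrite {}aE {}bE in ab0 gapE J *.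
have ab : al != be by apply/eqP => abE; apply: ab0; rewrite abE.
have J_ends t : t = psi (Some al) \/ t = psi (Some be) -> J t.
  by case=> ->; split; [exact: EEn|right; left|exact: EEn|right; right].
have gapK y : oitv (Some al) (Some be) (Some y) -> ~ K y.
  by move=> yab; apply: gapE; rewrite oitv_mob.
move: ab; rewrite neq_lt => /orP[lt|gt]; last first.
  (* In this case the gap contains the infinity of the chart, that is [xs]. All nodes lie in
     [[be, al]], so no level vanishes in the gap and all three claims follow from the first
     shape. *)
  have out t : oitv (Some al) (Some be) t -> ~ En (rlift (psi t)).
    move=> tab /En_level[k k1]; case: t tab => [y|] tab /=; last first.
      by move/eqP; apply/negP; exact: (level_degree szs srt sTP sTQ alt Tlvl0 k1).
    move/eqP; apply/negP; apply: (level_outside szs srt sTP sTQ alt Tlvl0 k1).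
    have /(oitv_gt _ gt)/(_ y erefl) yab := tab.
    have inside x : x \in sq -> be <= x <= al.
      move=> xs'; apply/andP; split; rewrite leNgt; apply/negP => h;
      by apply: (gapK x _ (sqK x xs')); apply/(oitv_gt _ gt) => z [<-]; auto.
    case: yab => h; [left|right] => x /inside /andP[h1 h2].
      exact: lt_le_trans h h1.
    exact: le_lt_trans h2 h.
  have s1 : shape1 J (psi (Some al)) (psi (Some be)).
    move=> t; split; last exact: J_ends.
    move=> [Et [tab|//]]; have [t' tE] := mob_preimage det t.
    rewrite tE oitv_mob // in tab; rewrite tE in Et.
    by case: (out t' tab Et).
  split=> //; apply: shape1_exclusive => //; exists (psi None).
  by rewrite oitv_mob //; apply/oitv_gt.
have sq_out x : x \in sq -> ~ al < x < be.
  by move=> /sqK Kx h; apply: (gapK x) => //; apply/oitv_lt => //; exists x.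
have [u [v [uv uvE band]]] := gap_band szs srt sTP sTQ alt Tlvl0 lt sq_out
  EP_level EP_intro EP_common.
have JE t : J (psi t) <-> exists y, t = Some y /\
    [\/ y = al, y = be | (al < y < be) && (u <= y <= v)].
  rewrite /J citv_mob // citv_lt //; split=> [[Et [y tE yab]]|[y [tE yab]]].
    exists y; split=> //; rewrite tE in Et.
    have [->|ya] := eqVneq y al; first by constructor 1.
    have [->|yb] := eqVneq y be; first by constructor 2.
    have yab' : al < y < be by rewrite !lt_neqAle eq_sym ya yb.
    by constructor 3; rewrite yab'; apply/band.
  rewrite tE; case: yab => [->|->|/andP[yab yuv]].
  - by split; [exact: EEn|exists al => //; rewrite lexx ltW].
  - by split; [exact: EEn|exists be => //; rewrite lexx ltW].
  split; first by apply/band.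
  by exists y => //; move: yab => /andP[/ltW-> /ltW->].
split.
- by rewrite shape1_mob // shape2_mob // shape3_mob // shape4_mob //;
    apply: band_shapes uvE _.
(* A gap that is a bounded interval of the chart does not contain [xs], so this claim is vacuous
   here. *)
- by rewrite -psi_xs oitv_mob // => /(oitv_lt _ lt)[].
move=> [c0 [c0ab Dc0 D0c0]].
have [t c0E] := mob_preimage det c0; rewrite c0E oitv_mob // in c0ab.
have [x tE xab] := (oitv_lt _ lt).1 c0ab.
have psix : psi (Some x) = c0 by rewrite c0E tE.
(* Both forms vanish at [c0], so the band does not meet the gap. *)
have q0 : pev n Q c0 = 0 by apply/eqP; rewrite QD.
have p0 : pev n P c0 = 0.
  exact: common_zero_of_divisor us supp Dn FP FQ g0 sP Dc0 D0c0.
rewrite shape1_mob // => z; rewrite /= JE; split.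
  move=> [y [-> [->|->|/andP[yab yuv]]]]; [by left|by right|exfalso].
  have := band y yab; rewrite yuv => -[_ /(_ isT)].
  apply: (gap_common_zero szs srt sTP sTQ alt Tlvl0 lt sq_out EP_level EP_common xab) => //.
    by rewrite (TEy P x sP) psix p0 mulr0.
  by rewrite (TEy Q x sQ) psix q0 mulr0.
by case=> ->; [exists al; split=> //; constructor 1|exists be; split=> //; constructor 2].
Qed.
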